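(* For every $n\ge1$ there exists a $C^\infty$ function $\gamma:S^n\to\mathbb{R}_{>0}$ which is not a convex integrand such that there exist closed embedded self-similar shrinking solutions of the anisotropic mean curvature flow for $\gamma$ in $\mathbb{R}^{n+1}$, each of which is homeomorphic to $S^n$ and is not (any homothety or translation of) the Wulff shape $W_\gamma$.
   Context: $\gamma$ is a convex integrand if its homogeneous extension $\overline\gamma(rX)=r\gamma(X)$ ($X\in S^n$, $r\ge0$) is convex on $\mathbb{R}^{n+1}$. $W_\gamma$ is the boundary of $\bigcap_{\nu\in S^n}\{X:\langle X,\nu\rangle\le\gamma(\nu)\}$. The Cahn–Hoffman map is $\xi_\gamma(\nu)=D\gamma|_\nu+\gamma(\nu)\nu$. For a piecewise-$C^2$ hypersurface $X$ with unit normal $\nu$ (defined off the singular set), the Cahn–Hoffman field is $\tilde\xi=\xi_\gamma\circ\nu$ and the anisotropic mean curvature at regular points is $\Lambda=-\frac1n\operatorname{trace}(d\tilde\xi)$. A one-parameter family $X_t:M\to\mathbb{R}^{n+1}$ of piecewise-$C^2$ embedded hypersurfaces whose Cahn–Hoffman fields $\tilde\xi_t$ are defined on $M$ is an anisotropic mean curvature flow if $\partial X_t/\partial t=\Lambda_t\tilde\xi_t$; it is a self-similar shrinking solution if each $X_t$ is a homothety of a fixed hypersurface with scaling factor decreasing in $t$. ''Not a homothety or translation of $W_\gamma$'' means the image is not of the form $aW_\gamma+b$, $a>0$. *)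

(* Defs.v *)
From HB Require Import structures.
From mathcomp Require Import all_boot all_order all_algebra.
From mathcomp Require Import all_classical all_reals.
From mathcomp Require Import topology normedtype derive.
Set Implicit Arguments. Unset Strict Implicit. Unset Printing Implicit Defensive.
Import Order.TTheory GRing.Theory Num.Theory.
Import numFieldNormedType.Exports.
Local Open Scope classical_set_scope.
Local Open Scope ring_scope.

Section AnisoDefs.
Variable R : realType.
Variable n : nat.
Local Notation V := 'rV[R]_n.+1.

Definition dotv (u v : V) : R := \sum_(i < n.+1) u 0 i * v 0 i.
Definition enorm (u : V) : R := Num.sqrt (dotv u u).
Definition sphere : set V := [set x | enorm x = 1].
Definition normalize (x : V) : V := (enorm x)^-1 *: x.
Definition ebasis (k : 'I_n.+1) : V := delta_mx 0 k.
Definition tproj (p x : V) : V := x - dotv x p *: p.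

Fixpoint iderive (W : normedModType R) (vs : seq V) (f : V -> W) : V -> W :=
  match vs with
  | [::] => f
  | v :: vs' => fun x => derive (iderive vs' f) x v
  end.
Definition Ck_on (W : normedModType R) (k : nat) (U : set V) (f : V -> W) : Prop :=
  (forall vs : seq V, (size vs <= k)%N ->
     forall x, U x -> {for x, continuous (iderive vs f)}) /\
  (forall (vs : seq V) (v : V), (size vs < k)%N ->
     forall x, U x -> derivable (iderive vs f) x v).
Definition Cinf_on (W : normedModType R) (U : set V) (f : V -> W) : Prop :=
  forall k, Ck_on k U f.

Definition smooth_on_sphere (g : V -> R) : Prop :=
  exists (U : set V) (G : V -> R),
    [/\ open U, sphere `<=` U, Cinf_on U G & forall x, sphere x -> G x = g x].

Definition homog_ext (g : V -> R) (x : V) : R := enorm x * g (normalize x).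
Definition convex_integrand (g : V -> R) : Prop :=
  forall (x y : V) (t : R), 0 <= t <= 1 ->
    homog_ext g ((1 - t) *: x + t *: y)
      <= (1 - t) * homog_ext g x + t * homog_ext g y.

Definition wulff_body (g : V -> R) : set V :=
  [set X | forall nu, sphere nu -> dotv X nu <= g nu].
Definition wulff_shape (g : V -> R) : set V :=
  closure (wulff_body g) `\` interior (wulff_body g).

(* D gamma |_nu : the gradient of gamma on S^n, computed as the ambient
   gradient of the degree-0 homogeneous extension  x |-> gamma(x/|x|)
   (which is tangent to S^n at nu) *)
Definition sgrad (g : V -> R) (nu : V) : V :=
  \row_k derive (g \o normalize) nu (ebasis k).
Definition cahn_hoffman (g : V -> R) (nu : V) : V := sgrad g nu + g nu *: nu.

(* derivative of a map defined on S^n at p in the tangent direction v,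
   along the curve s |-> (p + s v)/|p + s v| *)
Definition sD (W : normedModType R) (f : V -> W) (p v : V) : W :=
  derive1 (fun s : R => f (normalize (p + s *: v))) 0.

Definition relint (A : set V) : set V :=
  [set p | sphere p /\ exists2 e : R, 0 < e &
      forall q, sphere q -> enorm (q - p) < e -> A q].

(* X : S^n -> R^{n+1} is a topological embedding (S^n compact) *)
Definition sphere_embedding (X : V -> V) : Prop :=
  {within sphere, continuous X} /\
  (forall p q, sphere p -> sphere q -> X p = X q -> p = q).

Definition pc2_decomp (X : V -> V) (m : nat) (P : 'I_m -> set V) : Prop :=
  [/\ forall q, sphere q -> exists i, P i q,
      forall i, P i `<=` sphere /\ closed (P i),
      forall i, P i = closure (relint (P i)),
      forall i j, i != j -> relint (P i) `&` relint (P j) = set0 &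
      forall i, exists (U : set V) (F : V -> V),
        [/\ open U, P i `<=` U, Ck_on 2 U F,
            forall p, P i p -> F p = X p &
            forall p v, P i p -> dotv v p = 0 -> v != 0 -> derive F p v != 0]].

Definition regpt (m : nat) (P : 'I_m -> set V) (p : V) : Prop :=
  exists i, relint (P i) p.

Definition image_sphere (X : V -> V) : set V := X @` sphere.
Definition enclosed (X : V -> V) (x : V) : Prop :=
  ~ image_sphere X x /\
  bounded_set (connected_component (~` image_sphere X) x).

Definition outward_normal (X : V -> V) (p nu : V) : Prop :=
  [/\ enorm nu = 1,
      forall v, dotv v p = 0 -> dotv (sD X p v) nu = 0 &
      exists2 e : R, 0 < e & forall s, 0 < s < e ->
        enclosed X (X p - s *: nu) /\ ~ enclosed X (X p + s *: nu)].

(* anisotropic mean curvature  Lambda = -(1/n) trace(d xi~)  at a regular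
   point p, xi~ = xi_gamma o nu.  The trace of the endomorphism
   d xi~ o (dX)^{-1} of nu^perp is computed as the trace of
   Bt * At^{-1}, where At x = dX(Px) + <x,p> nu, Bt x = d xi~(Px),
   P = orthogonal projection on T_p S^n (row-vector convention). *)
Definition aniso_mc (g : V -> R) (X : V -> V) (nu : V -> V) (p : V) : R :=
  let At : 'M[R]_n.+1 := \matrix_(k, j)
      (sD X p (tproj p (ebasis k)) + p 0 k *: nu p) 0 j in
  let Bt : 'M[R]_n.+1 := \matrix_(k, j)
      (sD (fun q => cahn_hoffman g (nu q)) p (tproj p (ebasis k))) 0 j in
  - (n%:R)^-1 * \tr (Bt *m invmx At).

Definition aniso_mcf (g : V -> R) (a b : R) (X : R -> V -> V) : Prop :=
  forall t, a < t < b ->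
    sphere_embedding (X t) /\
    exists (m : nat) (P : 'I_m -> set V) (nu : V -> V),
      [/\ pc2_decomp (X t) P,
          forall p, regpt P p -> outward_normal (X t) p (nu p),
          (* the Cahn--Hoffman field is defined on all of M = S^n *)
          exists xi : V -> V, {within sphere, continuous xi} /\
            (forall p, regpt P p -> xi p = cahn_hoffman g (nu p)) &
          forall p, regpt P p ->
            derivable (fun s => X s p) t 1 /\
            derive1 (fun s => X s p) t =
              aniso_mc g (X t) nu p *: cahn_hoffman g (nu p)].

Definition self_similar_shrinking (a b : R) (X : R -> V -> V) : Prop :=
  exists (Y : V -> V) (c : V) (lam : R -> R),
    [/\ forall t, a < t < b -> 0 < lam t,
        forall s t, a < s -> s < t -> t < b -> lam t < lam s &
        forall t p, a < t < b -> sphere p -> X t p = lam t *: Y p + c].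

End AnisoDefs.

(* Main.v *)
(* Let Y be the surface of the body obtained from the unit ball by pressing a
   concave paraboloid dimple into its top: Y is a round part together with the
   dimple, glued along the rim {x0 = 3/5}.  The outer normals of the two parts
   occupy the disjoint ranges {nu_0 < 3/5} and {nu_0 > 7/8}, so a single smooth
   positive axially symmetric gamma can equal the support function of the round
   part on the first range and that of the dimple on the second.  Then the
   Cahn-Hoffman map takes the outer normal at a regular point of Y to the point
   itself, hence Lambda = -1/l on l Y, and sqrt(-2t) Y shrinks self-similarly.
   Moreover gamma is not convex near the axis, because the dimple is concave,
   and Y is not a Wulff shape, because it does not bound a convex body. *)
Require Import Defs.
From HB Require Import structures.
From mathcomp Require Import all_boot all_order all_algebra.
From mathcomp Require Import all_classical all_reals.
From mathcomp Require Import topology normedtype derive.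
From mathcomp Require Import sequences realfun exp.
From mathcomp Require Import ring lra.
Set Implicit Arguments. Unset Strict Implicit. Unset Printing Implicit Defensive.
Import Order.TTheory GRing.Theory Num.Theory.
Import numFieldNormedType.Exports.
Local Open Scope classical_set_scope.
Local Open Scope ring_scope.

(** Where a smooth [gamma] agrees with the support function of a hypersurface, its Cahn-Hoffman map
    inverts the Gauss map: [<Y,nu>] has differential [<Y,d nu>], because [dY] is orthogonal to [nu],
    so the tangential gradient and the value times [nu] add up to [Y]. The sign of the curvature
    does not enter, which is what makes a concave part possible. The obstacle is to have one
    positive [gamma] serve both parts. With [r] the distance to the axis, the paraboloid
    [x0 = 2/5 + 5/16 r^2] meets the unit sphere at [r = 4/5], height [3/5], with slope only [1/2].
    Its upward normals therefore have axial coordinate at least [2 / sqrt 5 > 7/8], far from the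
    round range. Its tangent planes cross the axis at height [2/5 - 5/16 r^2 >= 1/5], so its support
    function is positive. Between the two ranges [gamma] is only constrained by positivity, and the
    interpolation takes place on [[5/6, 7/8]], where both support functions are positive. *)

Section Derivatives.

(** * Directional derivatives and smooth functions of one variable *)

Variable R : realType.

Lemma is_derive_line (V W : normedModType R) (f : V -> W) (x v : V) (d : W) :
  is_derive (0 : R) 1 (fun s : R => f (s *: v + x)) d <-> is_derive x v f d.
Proof.
have E : 'D_1 (fun s : R => f (s *: v + x)) 0 = 'D_v f x.
  rewrite /derive; set F := fun h => _; set G := fun h => _.
  suff -> : F = G by [].
  by apply/funext => h; rewrite /F /G /= addr0 scale0r add0r [_%:A]mulr1.
split=> -[df <-]; split=> //; first exact: (derivable1P f x v).2.
exact: (derivable1P f x v).1.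
Qed.

Lemma is_deriveZl (V W : normedModType R) (k : V -> R) (x v : V) (dk : R)
    (u : W) :
  is_derive x v k dk -> is_derive x v (fun z => k z *: u) (dk *: u).
Proof.
move=> /is_derive_line H; apply/is_derive_line; case: H => kd <-.
have kd' := (derivable1_diffP _ _).1 kd.
split; first exact/derivable1_diffP/differentiableZl.
rewrite !deriveE//; last exact: differentiableZl.
by rewrite diffZl.
Qed.

Lemma is_derive_comp1 (V : normedModType R) (phi : R -> R) (k : V -> R)
    (x v : V) (dk dphi : R) :
  is_derive (k x) 1 phi dphi -> is_derive x v k dk ->
  is_derive x v (phi \o k) (dphi * dk).
Proof.
move=> pd /is_derive_line kd; apply/is_derive_line.
apply: (is_derive1_comp (g := fun s : R => k (s *: v + x))) => //.
by rewrite scale0r add0r.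
Qed.

Lemma is_derive_mul (V : normedModType R) (f g : V -> R) (x v : V)
    (df dg : R) :
  is_derive x v f df -> is_derive x v g dg ->
  is_derive x v (fun y => f y * g y) (f x * dg + g x * df).
Proof. exact: is_deriveM. Qed.

Lemma is_derive_add (V W : normedModType R) (f g : V -> W) (x v : V)
    (df dg : W) :
  is_derive x v f df -> is_derive x v g dg ->
  is_derive x v (fun y => f y + g y) (df + dg).
Proof. exact: is_deriveD. Qed.

Lemma is_derive_exp (V : normedModType R) (f : V -> R) n (x v : V) (df : R) :
  is_derive x v f df ->
  is_derive x v (fun y => f y ^+ n) (n%:R * f x ^+ n.-1 * df).
Proof.
move=> /(is_deriveX n); set F := f ^+ n; rewrite (_ : F = fun y => f y ^+ n)//.
by apply/funext => y; rewrite /F !fctE.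
Qed.

Lemma is_derive_inv (V : normedModType R) (f : V -> R) (x v : V) (df : R) :
  f x != 0 -> is_derive x v f df ->
  is_derive x v (fun y => (f y)^-1) (- (f x)^-1 ^+ 2 * df).
Proof.
move=> fx0 [fd <-]; split; first exact: derivableV.
by rewrite deriveV// exprVn.
Qed.

Definition smooth1 (f : R -> R) := forall k x, derivable (derive1n k f) x 1.

(** This acts as a coinduction principle: a class stable under differentiation contains all iterated
    derivatives of its members, so none of them has to be computed. *)
Lemma smooth1_closed (S : set (R -> R)) :
  (forall f, S f -> exists2 f', S f' & forall x : R, is_derive x 1 f (f' x)) ->
  S `<=` smooth1.
Proof.
move=> H f Sf k; have : S (derive1n k f).
  elim: k => [//|k /H[f' Sf' df']].
  rewrite derive1nS (_ : derive1 _ = f')//; apply/funext => x.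
  by rewrite derive1E; exact: derive_val.
by move=> /H[f' _ df'] x; have [] := df' x.
Qed.

Lemma smooth1_derive1 f : smooth1 f -> smooth1 (derive1 f).
Proof. by move=> fs k x; rewrite -derive1Sn; exact: fs. Qed.

Lemma smooth1_is_derive f (x : R) : smooth1 f -> is_derive x 1 f ((derive1 f) x).
Proof. by move=> /(_ 0%N x) fx; split=> //; rewrite derive1E. Qed.

Lemma smooth1_continuous f : smooth1 f -> continuous f.
Proof.
by move=> /(_ 0%N) fs x; apply/differentiable_continuous/derivable1_diffP/fs.
Qed.

(** * Functions that are affine up to a term in the axial coordinate *)

Section Profiles.
Variables (n : nat) (W : normedModType R).
Local Notation V := 'rV[R]_n.+1.

Definition axial_coord (x : V) : R := x 0 0.

Lemma axial_coord_continuous : continuous axial_coord.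
Proof. by move=> x; exact: coord_continuous. Qed.

Lemma is_derive_axial_coord (x v : V) : is_derive x v axial_coord (v 0 0).
Proof.
apply/is_derive_line.
have -> : (fun s : R => axial_coord (s *: v + x)) =
    (fun s : R => s *: v 0 0) + cst (x 0 0).
  by apply/funext => s; rewrite /axial_coord !mxE.
rewrite -[X in is_derive _ _ _ X](addr0 (v 0 0)).
apply: is_deriveD; rewrite -[X in is_derive _ _ _ X](scale1r (v 0 0)).
exact: is_deriveZl.
Qed.

(** A shape preserved by every directional derivative. It covers both [gamma] ([W] the reals,
    [L = 0]) and the parametrization of each part of the surface ([L] a homothety, [u] along the
    axis). *)
Definition profile (w : W) (L : V -> W) (phi : R -> R) (u : W) (x : V) : W :=
  w + L x + phi (axial_coord x) *: u.

(** Continuous linear maps, described by the only property that the calculus below uses. *)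
Definition derivative_of_itself (L : V -> W) :=
  continuous L /\ forall x v : V, is_derive x v L (L v).

Lemma derivative_of_itself0 : derivative_of_itself (fun _ => 0).
Proof. by split=> [|x v]; [exact: cst_continuous|exact: is_derive_cst]. Qed.

Lemma is_derive_profile w L phi u (x v : V) :
  derivative_of_itself L -> smooth1 phi ->
  is_derive x v (profile w L phi u)
    (profile (L v) (fun _ => 0) (derive1 phi) (v 0 0 *: u) x).
Proof.
move=> [_ dL] sphi; rewrite /profile addr0.
have d1 := is_derive_comp1 (smooth1_is_derive (axial_coord x) sphi)
  (is_derive_axial_coord x v).
rewrite scalerA -[L v]add0r.
exact: (is_deriveD (is_deriveD (is_derive_cst w x v) (dL x v))
  (is_deriveZl u d1)).
Qed.

Lemma profile_continuous w L phi u :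
  derivative_of_itself L -> smooth1 phi -> continuous (profile w L phi u).
Proof.
move=> [cL _] sphi x.
have c1 : {for x, continuous (phi \o axial_coord)}.
  apply: continuous_comp; first exact: axial_coord_continuous.
  exact: smooth1_continuous.
exact: (cvgD (cvgD (cvg_cst w) (cL x)) (cvgZ c1 (cvg_cst u))).
Qed.

Lemma iderive_profile w L phi u vs :
  derivative_of_itself L -> smooth1 phi ->
  exists w' L' phi' u', [/\ derivative_of_itself L', smooth1 phi' &
    iderive vs (profile w L phi u) = profile w' L' phi' u'].
Proof.
move=> dL sphi; elim: vs => [|v vs [w' [L' [phi' [u' [dL' sphi' E]]]]]] /=.
  by exists w, L, phi, u.
exists (L' v), (fun _ => 0), (derive1 phi'), (v 0 0 *: u'); split.
- exact: derivative_of_itself0.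
- exact: smooth1_derive1.
- apply/funext => x; rewrite E.
  exact: (@derive_val _ _ _ _ _ _ _ (is_derive_profile w' u' x v dL' sphi')).
Qed.

Lemma profile_Cinf w L phi u (U : set V) :
  derivative_of_itself L -> smooth1 phi -> Cinf_on U (profile w L phi u).
Proof.
move=> dL sphi k; split=> [vs _|vs v _] x _.
  have [w' [L' [phi' [u' [dL' sphi' ->]]]]] := iderive_profile w u vs dL sphi.
  exact: profile_continuous.
have [w' [L' [phi' [u' [dL' sphi' ->]]]]] := iderive_profile w u vs dL sphi.
by have [] := is_derive_profile w' u' x v dL' sphi'.
Qed.

End Profiles.
End Derivatives.

(** * A smooth step function *)

Section SmoothStep.
Variable R : realType.

(** The powers of [t^-1] are carried along because differentiating [expR (- t^-1)] produces them;
    the span of the family is then stable under differentiation. *)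
Definition flat (k : nat) (t : R) : R :=
  if 0 < t then (t^-1) ^+ k * expR (- t^-1) else 0.

Lemma flat_gt0 k t : 0 < t -> 0 < flat k t.
Proof. by move=> t0; rewrite /flat t0 mulr_gt0 ?exprn_gt0 ?invr_gt0 ?expR_gt0. Qed.

Lemma flat_eq0 k t : t <= 0 -> flat k t = 0.
Proof. by rewrite /flat; case: ltP. Qed.

Lemma flat_ge0 k t : 0 <= flat k t.
Proof. by case: (ltP 0 t) => [/flat_gt0/ltW|/flat_eq0->]. Qed.

(** The exponential of [t^-1] dominates the term of degree [k.+1] of its series. *)
Lemma flat_le k t : 0 < t -> flat k t <= k.+1`!%:R * t.
Proof.
move=> t0; rewrite /flat t0 expRN ler_pdivrMr ?expR_gt0//.
have tV0 : 0 <= t^-1 by rewrite invr_ge0 ltW.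
have f0 : 0 < k.+1`!%:R :> R by rewrite ltr0n fact_gt0.
have -> : t^-1 ^+ k = k.+1`!%:R * t * (t^-1 ^+ k.+1 / k.+1`!%:R).
  by rewrite exprS; field; rewrite !gt_eqF.
rewrite ler_pM2l ?mulr_gt0// (le_trans _ (expR_ge1Dxn k tV0))//.
by rewrite lerDr ler01.
Qed.

Lemma is_derive_flat k (t : R) :
  is_derive t 1 (flat k) (flat k.+2 t - k%:R * flat k.+1 t).
Proof.
case: (ltgtP t 0) => [t0|t0|->].
- rewrite !flat_eq0 ?ltW// mulr0 subr0.
  apply: (near_eq_is_derive _ (is_derive_cst 0 t 1)).
  near=> s; rewrite flat_eq0// ltW//; near: s; exact: lt_nbhsl.
- have tn0 : t != 0 by rewrite gt_eqF.
  have dV := is_derive_inv (f := id) tn0 (is_derive_id t 1).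
  have dE := is_derive_comp1 (k := fun s : R => - s^-1) (is_derive_expR (- t^-1))
    (is_deriveN dV).
  apply: is_derive_eq.
    apply: (near_eq_is_derive _ (is_derive_mul (is_derive_exp k dV) dE)).
    by apply: filterS (lt_nbhsr t0) => s s0; rewrite /flat s0.
  rewrite /flat t0 /=.
  by case: (k) => [|m]; rewrite ?exprS /=; ring.
- rewrite !flat_eq0// mulr0 subr0.
  (* At 0 the right difference quotient of [flat k] is [flat k.+1 h], which [flat_le] bounds by a
     multiple of [h]. *)
  have H : (fun h : R => h^-1 *: ((flat k \o shift 0) (h *: 1) - flat k 0))
      @ 0^' --> (0 : R).
    apply/cvgr0Pnorm_le => e e0; near=> h.
    have -> : (flat k \o shift 0) (h *: 1) = flat k h.
      by rewrite /= addr0 [_%:A]mulr1.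
    rewrite (flat_eq0 k (lexx 0)) subr0.
    have [h0|h0] := leP h 0; first by rewrite flat_eq0// scaler0 normr0 ltW.
    have -> : h^-1 *: flat k h = flat k.+1 h.
      by rewrite /flat h0 exprS -mulrA.
    rewrite ger0_norm ?flat_ge0// (le_trans (flat_le _ h0))//.
    rewrite -ler_pdivlMl ?ltr0n ?fact_gt0// (le_trans (ler_norm h))//.
    near: h; apply: dnbhs0_le.
    by rewrite mulr_gt0 ?invr_gt0 ?ltr0n ?fact_gt0.
  by split; [apply/cvg_ex; exists 0|exact/cvg_lim].
Unshelve. all: by end_near. Qed.

Variables (a b : R).
Hypotheses (a0 : 0 < a) (ab : a < b).

Let denom (s : R) := flat 0 (s - a) + flat 0 (b - s).

Let denom_gt0 s : 0 < denom s.
Proof.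
have [bs|sb] := ltP s b.
  by rewrite ltr_wpDl ?flat_ge0// flat_gt0// subr_gt0.
by rewrite ltr_pwDl ?flat_ge0// flat_gt0// subr_gt0 (lt_le_trans ab).
Qed.

Definition smooth_step (s : R) : R := flat 0 (s - a) / denom s.

Lemma smooth_step0 s : s <= a -> smooth_step s = 0.
Proof. by move=> sa; rewrite /smooth_step flat_eq0 ?mul0r// subr_le0. Qed.

Lemma smooth_step1 s : b <= s -> smooth_step s = 1.
Proof.
move=> bs; have := denom_gt0 s; rewrite /smooth_step /denom.
rewrite [flat 0 (b - s)]flat_eq0 ?subr_le0// addr0 => H.
by rewrite divff// gt_eqF.
Qed.

Lemma smooth_step_itv s : 0 <= smooth_step s <= 1.
Proof.
rewrite divr_ge0 ?flat_ge0// ?(ltW (denom_gt0 _))//=.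
by rewrite ler_pdivrMr// mul1r lerDl flat_ge0.
Qed.

(* The factor [s^-1] is harmless because [flat k (s - a)] vanishes for [s <= a],
   where [0 < a]. *)
Inductive step_algebra : (R -> R) -> Prop :=
| StepCst c : step_algebra (cst c)
| StepId : step_algebra id
| StepRight k j : step_algebra (fun s => flat k (s - a) * s^-1 ^+ j)
| StepLeft k : step_algebra (fun s => flat k (b - s))
| StepInv : step_algebra (fun s => (denom s)^-1)
| StepAdd f g : step_algebra f -> step_algebra g -> step_algebra (f + g)
| StepMul f g : step_algebra f -> step_algebra g -> step_algebra (f * g).

Let step_scale c f : step_algebra f -> step_algebra (fun s => c * f s).
Proof. by move=> sf; exact: (StepMul (StepCst c) sf). Qed.

Let is_derive_flatr k (s : R) : is_derive s 1 (fun s => flat k (s - a))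
  (flat k.+2 (s - a) - k%:R * flat k.+1 (s - a)).
Proof.
have := is_derive1_comp (g := shift (- a)) (is_derive_flat k _)
  (is_derive_shift s 1 (- a)).
by rewrite mulr1.
Qed.

Let is_derive_flatl k (s : R) : is_derive s 1 (fun s => flat k (b - s))
  (- flat k.+2 (b - s) + k%:R * flat k.+1 (b - s)).
Proof.
have d1 : is_derive s 1 (fun s : R => b - s) (0 - 1).
  exact: (is_deriveB (is_derive_cst b s 1) (is_derive_id s 1)).
have := is_derive1_comp (g := fun s => b - s) (is_derive_flat k _) d1.
by rewrite sub0r mulrN1 opprB addrC.
Qed.

Lemma step_algebra_derive f : step_algebra f ->
  exists2 f', step_algebra f' & forall x : R, is_derive x 1 f (f' x).
Proof.
elim=> [c||k j|k||{}f g _ [f' sf' df'] _ [g' sg' dg']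
       |{}f g sf [f' sf' df'] sg [g' sg' dg']].
- by exists (cst 0); [exact: StepCst|move=> x; exact: is_derive_cst].
- by exists (cst 1); [exact: StepCst|move=> x; exact: is_derive_id].
- exists ((fun s => flat k.+2 (s - a) * s^-1 ^+ j) +
    ((fun s => - k%:R * (flat k.+1 (s - a) * s^-1 ^+ j)) +
     (fun s => - j%:R * (flat k (s - a) * s^-1 ^+ j.+1)))).
    apply: StepAdd; first exact: StepRight.
    by apply: StepAdd; apply: step_scale; exact: StepRight.
  (* Left of [a] the product vanishes on a neighbourhood, including at the pole of [s^-1]; from [a]
     on, [s] is positive and the product rule applies. *)
  move=> s; have [sa|sa] := ltP s a.
    rewrite !fctE !flat_eq0 ?subr_le0 1?ltW// !(mul0r, mulr0, addr0).
    apply: (near_eq_is_derive _ (is_derive_cst 0 s 1)).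
    apply: filterS (lt_nbhsl sa) => t ta.
    by rewrite flat_eq0 ?mul0r// subr_le0 ltW.
  have s0 : s != 0 by rewrite gt_eqF// (lt_le_trans a0).
  have := is_derive_mul (is_derive_flatr k s)
    (is_derive_exp j (is_derive_inv (f := id) s0 (is_derive_id s 1))).
  move=> H; apply: (is_derive_eq H); rewrite !fctE.
  by case: (j) => [|m]; rewrite ?exprS /=; ring.
- exists ((fun s => - 1 * flat k.+2 (b - s)) +
          (fun s => k%:R * flat k.+1 (b - s))).
    by apply: StepAdd; apply: step_scale; exact: StepLeft.
  move=> s; rewrite !fctE mulN1r; exact: is_derive_flatl.
- exists ((fun s => - 1 * (((fun s => (denom s)^-1) * (fun s => (denom s)^-1)) *
    ((fun s => flat 2 (s - a) * s^-1 ^+ 0) +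
     (fun s => - 1 * flat 2 (b - s)))) s)).
    apply: step_scale; apply: StepMul; first by apply: StepMul; exact: StepInv.
    by apply: StepAdd; [|apply: step_scale]; constructor.
  move=> s; have n0 : denom s != 0 by rewrite gt_eqF.
  have := is_derive_inv n0
    (is_derive_add (is_derive_flatr 0 s) (is_derive_flatl 0 s)).
  by move=> H; apply: (is_derive_eq H); rewrite !fctE /=; ring.
- exists (f' + g'); [exact: StepAdd|move=> s; exact: is_deriveD].
- exists (f * g' + g * f').
    by apply: StepAdd; apply: StepMul.
  by move=> s; exact: is_deriveM.
Qed.

Lemma smooth_step_profile (c d : R) :
  smooth1 (fun s => 1 + (c * s - d * s^-1 - 1) * smooth_step s).
Proof.
have -> : (fun s => 1 + (c * s - d * s^-1 - 1) * smooth_step s) =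
  cst 1 + (((cst c * id + cst (- 1)) * (fun s => flat 0 (s - a) * s^-1 ^+ 0) +
    cst (- d) * (fun s => flat 0 (s - a) * s^-1 ^+ 1)) * (fun s => (denom s)^-1)).
  by apply/funext => s; rewrite /smooth_step !fctE /=; ring.
by apply: smooth1_closed step_algebra_derive _ _; repeat constructor.
Qed.

End SmoothStep.

(** * Differentiation on the sphere and anisotropic mean curvature *)

Section Euclid.
Variables (R : realType) (n : nat).
Local Notation V := 'rV[R]_n.+1.
Implicit Types u v w x p : V.

Lemma dotvC u v : dotv u v = dotv v u.
Proof. by apply: eq_bigr => i _; rewrite mulrC. Qed.

Lemma dotvDl u v w : dotv (u + v) w = dotv u w + dotv v w.
Proof. by rewrite /dotv -big_split; apply: eq_bigr => i _; rewrite mxE mulrDl. Qed.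

Lemma dotvZl c u v : dotv (c *: u) v = c * dotv u v.
Proof. by rewrite /dotv mulr_sumr; apply: eq_bigr => i _; rewrite mxE mulrA. Qed.

Lemma dotvDr u v w : dotv w (u + v) = dotv w u + dotv w v.
Proof. by rewrite !(dotvC w) dotvDl. Qed.

Lemma dotvZr c u v : dotv u (c *: v) = c * dotv u v.
Proof. by rewrite !(dotvC u) dotvZl. Qed.

Lemma dotvNl u v : dotv (- u) v = - dotv u v.
Proof. by rewrite -scaleN1r dotvZl mulN1r. Qed.

Lemma dotvNr u v : dotv u (- v) = - dotv u v.
Proof. by rewrite !(dotvC u) dotvNl. Qed.

Lemma dotv0l v : dotv 0 v = 0.
Proof. by rewrite -(scale0r v) dotvZl mul0r. Qed.

Definition dotvE :=
  (dotvDl, dotvDr, dotvZl, dotvZr, dotvNl, dotvNr).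

Lemma dotv_ebasis u k : dotv u (ebasis R k) = u 0 k.
Proof.
rewrite /dotv (bigD1 k)//= big1 ?addr0 => [|i ik]; rewrite /ebasis mxE !eqxx /=.
  by rewrite mulr1.
by rewrite (negbTE ik) mulr0.
Qed.

Lemma dotv_mulmx u v : dotv u v = (u *m v^T) 0 0.
Proof. by rewrite mxE; apply: eq_bigr => i _; rewrite mxE. Qed.

Lemma ge_dotv0 u i : u 0 i ^+ 2 <= dotv u u.
Proof.
rewrite /dotv (bigD1 i)//= -expr2 lerDl sumr_ge0// => j _.
by rewrite -expr2 sqr_ge0.
Qed.

Lemma dotv_ge0 u : 0 <= dotv u u.
Proof. by apply: le_trans (ge_dotv0 u 0); exact: sqr_ge0. Qed.

Lemma dotv_eq0 u : dotv u u = 0 -> u = 0.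
Proof.
move=> u0; apply/rowP => i; rewrite mxE; apply/eqP.
by rewrite -sqrf_eq0 eq_le sqr_ge0 andbT -u0 ge_dotv0.
Qed.

Lemma enorm_sqr u : enorm u ^+ 2 = dotv u u.
Proof. by rewrite sqr_sqrtr ?dotv_ge0. Qed.

Lemma sphereP u : sphere u <-> dotv u u = 1.
Proof.
split=> [h|h]; first by rewrite -enorm_sqr h expr1n.
by rewrite /sphere /= /enorm h sqrtr1.
Qed.

Lemma sphere_coord_le u i : sphere u -> -1 <= u 0 i <= 1.
Proof.
move/sphereP => u1; rewrite -ler_norml -(ler_pXn2r (n := 2))// ?nnegrE//.
by rewrite expr1n -normrX ger0_norm ?sqr_ge0// -u1 ge_dotv0.
Qed.

Lemma enorm_gt0 u : u != 0 -> 0 < enorm u.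
Proof.
move=> u0; rewrite sqrtr_gt0 lt_neqAle dotv_ge0 andbT eq_sym.
by apply: contraNneq u0 => /dotv_eq0 ->.
Qed.

Lemma normalize_sphere u : u != 0 -> sphere (normalize u).
Proof.
move=> u0; apply/sphereP; rewrite !dotvE -enorm_sqr.
by have := enorm_gt0 u0; move: (enorm u) => e e0; field; rewrite gt_eqF.
Qed.

Lemma normalize_id u : sphere u -> normalize u = u.
Proof. by rewrite /sphere/normalize /= => ->; rewrite invr1 scale1r. Qed.

Lemma dotv_tproj p x : sphere p -> dotv (tproj p x) p = 0.
Proof. by move/sphereP => p1; rewrite /tproj !dotvE p1 mulr1 subrr. Qed.

Lemma tproj_id p x : dotv x p = 0 -> tproj p x = x.
Proof. by rewrite /tproj => ->; rewrite scale0r subr0. Qed.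

Lemma is_derive_coord (U : normedModType R) (c : U -> V) (x v : U) (dc : V) i :
  is_derive x v c dc -> is_derive x v (fun y => c y 0 i) (dc 0 i).
Proof.
move=> [cd <-]; split; first exact: (derivable_mxP c x v).1.
by rewrite derive_mx// mxE.
Qed.

Lemma is_derive_normalize p v : sphere p ->
  is_derive (0 : R) 1 (fun s : R => normalize (p + s *: v)) (tproj p v).
Proof.
move=> sp; have p1 := (sphereP p).1 sp.
pose m (s : R) := 1 + (dotv v p *+ 2 * s + dotv v v * s ^+ 2).
have mE s : enorm (p + s *: v) = Num.sqrt (m s).
  by rewrite /enorm !dotvE p1 /m (dotvC p v); congr Num.sqrt; ring.
have m0 : m 0 = 1 by rewrite /m !(mulr0, expr0n, addr0).
have dm : is_derive (0 : R) 1 m (dotv v p *+ 2).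
  have := is_derive_add (is_derive_cst (1 : R) (0 : R) (1 : R))
    (is_derive_add
      (is_derive_mul (is_derive_cst (dotv v p *+ 2) (0 : R) (1 : R)) (is_derive_id (0 : R) (1 : R)))
      (is_derive_mul (is_derive_cst (dotv v v) (0 : R) (1 : R))
         (is_derive_exp 2 (is_derive_id (0 : R) (1 : R))))).
  by move=> H; apply: (is_derive_eq H); rewrite /cst /=; ring.
have sm0 : Num.sqrt (m 0) = 1 by rewrite m0 sqrtr1.
have ds : is_derive (m 0) 1 Num.sqrt (2 * Num.sqrt (m 0))^-1.
  by apply: is_derive1_sqrt; rewrite m0.
have nz : Num.sqrt (m 0) != 0 by rewrite sm0 oner_eq0.
have dk : is_derive (0 : R) 1 (fun s => (Num.sqrt (m s))^-1) (- dotv v p).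
  apply: (is_derive_eq (is_derive_inv (f := Num.sqrt \o m) nz
    (is_derive_comp1 ds dm))).
  by rewrite /= sm0; field.
have dks := is_derive_mul dk (is_derive_id (0 : R) (1 : R)).
have D := is_derive_add (is_deriveZl p dk) (is_deriveZl v dks).
have -> : (fun s : R => normalize (p + s *: v)) =
   (fun s => (Num.sqrt (m s))^-1 *: p + ((Num.sqrt (m s))^-1 * s) *: v).
  by apply/funext => s; rewrite /normalize mE scalerDr scalerA.
apply: (is_derive_eq D); rewrite sm0 invr1 mul0r addr0 mulr1 scale1r addrC.
by rewrite scaleNr.
Qed.

Lemma normalize_curve0 p v : sphere p -> normalize (p + 0 *: v) = p.
Proof. by move=> sp; rewrite scale0r addr0 normalize_id. Qed.

Lemma near_normalize p v (Q : set V) : sphere p ->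
  (\forall x \near p, sphere x -> Q x) ->
  \forall s \near (0 : R), Q (normalize (p + s *: v)).
Proof.
move=> sp nQ; have [/derivable1_diffP/differentiable_continuous cq _] :=
  is_derive_normalize v sp.
(* [normalize] sends 0 to 0, off the sphere. The inner product of the curve with [p] stays positive
   for small [s], which excludes this. *)
have nz : \forall s \near (0 : R), p + s *: v != 0.
  have c3 : (1 + s * dotv v p) @[s --> (0 : R)] --> (1 + 0 * dotv v p : R).
    exact: (cvgD (cvg_cst (1 : R)) (cvgM cvg_id (cvg_cst (dotv v p)))).
  rewrite mul0r addr0 in c3.
  have : \forall s \near (0 : R), 0 < 1 + s * dotv v p.
    exact: (c3 _ (lt_nbhsr (ltr01 : (0 : R) < 1))).
  apply: filterS => s s0.
  apply/eqP => E; have : dotv (p + s *: v) p = 0 by rewrite E dotv0l.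
  rewrite !dotvE ((sphereP p).1 sp) => s1.
  by move: s0; rewrite /= s1 ltxx.
have nq : \forall s \near (0 : R), sphere (normalize (p + s *: v)) ->
    Q (normalize (p + s *: v)).
  have : nbhs (normalize (p + (0 : R) *: v)) [set x | sphere x -> Q x].
    by rewrite normalize_curve0.
  exact: (cq [set x | sphere x -> Q x]).
by apply: filterS2 nz nq => s s0; apply; exact: normalize_sphere.
Qed.

Lemma sD_profile p v (f : V -> V) l phi u : sphere p -> smooth1 phi ->
  (\forall x \near p, sphere x -> f x = l *: x + phi (x 0 0) *: u) ->
  sD f p v = l *: tproj p v + (derive1 phi (p 0 0) * (tproj p v) 0 0) *: u.
Proof.
move=> sp sphi fE; have dq := is_derive_normalize v sp.
pose q (s : R) := normalize (p + s *: v).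
have nE : \forall s \near (0 : R), f (q s) = l *: q s + phi (q s 0 0) *: u.
  exact: (@near_normalize p v
    [set x | f x = l *: x + phi (x 0 0) *: u] sp fE).
rewrite /sD derive1E (near_eq_derive _ nE).
have d1 := is_derive_comp1 (phi := phi)
  (k := fun s : R => normalize (p + s *: v) 0 0)
  (smooth1_is_derive _ sphi) (is_derive_coord 0 dq).
have d2 := is_derive_add (is_deriveZ l dq) (is_deriveZl u d1).
by rewrite (@derive_val _ _ _ _ _ _ _ d2) normalize_curve0.
Qed.

Lemma cahn_hoffman_axial (f : R -> R) nu : smooth1 f -> sphere nu ->
  cahn_hoffman (fun x => f (x 0 0)) nu =
    derive1 f (nu 0 0) *: ebasis R 0
      + (f (nu 0 0) - nu 0 0 * derive1 f (nu 0 0)) *: nu.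
Proof.
move=> sf snu.
have E k : derive ((fun x => f (x 0 0)) \o @normalize R n) nu (ebasis R k) =
    derive1 f (nu 0 0) * (tproj nu (ebasis R k)) 0 0.
  have dq := is_derive_normalize (ebasis R k) snu.
  have d1 := is_derive_comp1 (phi := f)
    (k := fun s : R => normalize (nu + s *: ebasis R k) 0 0)
    (smooth1_is_derive _ sf) (is_derive_coord 0 dq).
  rewrite /= normalize_curve0// in d1.
  apply: derive_val; apply/is_derive_line.
  rewrite (_ : (fun _ => _) = f \o (fun s : R => normalize (nu + s *: ebasis R k) 0 0))//.
  by apply/funext => s /=; rewrite addrC.
apply/rowP => k; rewrite !mxE E /tproj !mxE !eqxx /= (dotvC _ nu) dotv_ebasis.
by rewrite (eq_sym 0 k); ring.
Qed.

(** [M] is the common differential of the Cahn-Hoffman field and of the unscaled surface. Then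
    [Bt = l^-1 (At - p^T nu)] and [p At = nu], so [Bt At^-1 = l^-1 (1 - p^T p)]: up to the factor
    [l^-1] a projection of rank [n], whose trace is independent of [M]. *)
Lemma aniso_mc_shrinker (g : V -> R) (X nu : V -> V) p l (M : 'M[R]_n.+1) :
  (0 < n)%N -> l != 0 -> sphere p -> sphere (nu p) ->
  (forall v, sD X p v = l *: (tproj p v *m M)) ->
  (forall v, sD (fun q => cahn_hoffman g (nu q)) p v = tproj p v *m M) ->
  (forall v, dotv (tproj p v *m M) (nu p) = 0) ->
  (forall v, dotv v p = 0 -> v *m M = 0 -> v = 0) ->
  aniso_mc g X nu p = - l^-1.
Proof.
move=> n0 l0 sp snu XE NE MN Minj; rewrite /aniso_mc.
have p1 := (sphereP p).1 sp; have nu1 := (sphereP _).1 snu.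
have pp : p *m p^T = 1%:M.
  by apply/matrixP => i j; rewrite !ord1 -dotv_mulmx p1 mxE.
pose P : 'M[R]_n.+1 := 1%:M - p^T *m p.
have PE v : tproj p v = v *m P.
  rewrite /tproj mulmxBr mulmx1 mulmxA; congr (_ - _).
  by apply/rowP => j; rewrite dotv_mulmx mxE [RHS]mxE big_ord1.
set Bt := \matrix_(k, j) _; set At := \matrix_(k, j) _.
have BtE : Bt = P *m M.
  apply/matrixP => k j; rewrite /Bt mxE NE tproj_id ?dotv_tproj// PE -mulmxA /ebasis -rowE.
  by rewrite [LHS]mxE.
have AtE : At = l *: (P *m M) + p^T *m nu p.
  apply/matrixP => k j; rewrite /At mxE XE tproj_id ?dotv_tproj// PE -mulmxA /ebasis -rowE.
  rewrite [RHS]mxE [X in _ = _ + X]mxE big_ord1 [p^T _ _]mxE.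
  by move: (P *m M) => Q; rewrite !mxE.
have pAt : p *m At = nu p.
  rewrite AtE mulmxDr -scalemxAr !mulmxA mulmxBr mulmx1 mulmxA pp !mul1mx.
  by rewrite subrr mul0mx scaler0 add0r.
(* Pairing [x At = 0] with [nu p] removes the part tangent to the surface and leaves [<x,p> = 0];
   injectivity of [M] on tangent vectors finishes. *)
have uAt : At \in unitmx.
  rewrite -row_free_unit; apply: inj_row_free => x xAt.
  have xp : dotv x p = 0.
    have : dotv (x *m At) (nu p) = 0 by rewrite xAt dotv0l.
    rewrite AtE mulmxDr -scalemxAr !mulmxA -PE dotvDl dotvZl MN mulr0 add0r.
    by rewrite [x *m p^T]mx11_scalar -dotv_mulmx mul_scalar_mx dotvZl nu1 mulr1.
  have tx := tproj_id xp.
  apply: Minj => //; move: xAt.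
  rewrite AtE mulmxDr -scalemxAr !mulmxA -PE tx.
  rewrite [x *m p^T]mx11_scalar -dotv_mulmx xp mul_scalar_mx scale0r addr0.
  by move/eqP; rewrite scaler_eq0 (negbTE l0) => /eqP.
have -> : Bt = l^-1 *: (At - p^T *m nu p).
  by rewrite AtE addrK scalerA mulVf// scale1r.
rewrite -{1}pAt mulmxA -scalemxAl mulmxBl mulmxV// mulmxK//.
rewrite mxtraceZ raddfB /= mxtrace1 mxtrace_mulC pp mxtrace1 -natrB// subn1 /=.
rewrite mulNr mulrCA mulVf ?mulr1// pnatr_eq0 -lt0n//.
Qed.

End Euclid.

(** * The dimpled sphere and the regions it separates *)

Section DimpledBall.
Variables (R : realType) (n : nat).
Local Notation V := 'rV[R]_n.+1.
Implicit Types (u v w x p q : V) (l s t : R).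
Local Notation e0 := (@ebasis R n 0).

(** On the sphere [1 - t^2] is the squared distance to the axis, so this is the height of the
    paraboloid minus the height [t] of the point above or below it. Its roots are [3/5] and [-19/5];
    only the rim lies in [[-1, 1]]. *)
Definition dent t : R := 2 / 5 + 5 / 16 * (1 - t ^+ 2) - t.

Definition dimpled p : V := p + Num.min 0 (dent (p 0 0)) *: e0.

Lemma coord_le_norm x i : `|x 0 i| <= `|x|.
Proof.
rewrite /Num.Def.normr /= mx_normrE.
exact: (le_bigmax _ (fun ij => `|x ij.1 ij.2|) (0, i)).
Qed.

Lemma ebasis00 : e0 0 0 = 1.
Proof. by rewrite mxE !eqxx. Qed.

Lemma dotv_e0r u : dotv u e0 = u 0 0.
Proof. exact: dotv_ebasis. Qed.

Lemma dotv_e0l u : dotv e0 u = u 0 0.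
Proof. by rewrite dotvC dotv_ebasis. Qed.

Lemma coord_axial u t i : (u + t *: e0) 0 i = u 0 i + t * (i == 0)%:R.
Proof. by rewrite !mxE !eqxx. Qed.

Lemma dent_ge0 t : -1 <= t -> t <= 3 / 5 -> 0 <= dent t.
Proof. rewrite /dent => t1 t2; nra. Qed.

Lemma dent_le0 t : 3 / 5 <= t -> dent t <= 0.
Proof. rewrite /dent => t1; nra. Qed.

Lemma dimpled_low p : sphere p -> p 0 0 <= 3 / 5 -> dimpled p = p.
Proof.
move=> /(sphere_coord_le 0)/andP[p1 _] p2; rewrite /dimpled min_l ?dent_ge0//.
by rewrite scale0r addr0.
Qed.

Lemma dimpled_high p : 3 / 5 <= p 0 0 -> dimpled p = p + dent (p 0 0) *: e0.
Proof. by move=> p1; rewrite /dimpled min_r ?dent_le0. Qed.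

Let continuous_sumr m (F : 'I_m -> V -> R) : (forall i, continuous (F i)) ->
  continuous (fun x => \sum_(i < m) F i x).
Proof.
elim: m F => [|m IH] F cF x.
  rewrite (_ : (fun x => \sum_(i < 0) F i x) = cst 0); first exact: cst_continuous.
  by apply/funext => y; rewrite big_ord0.
rewrite (_ : (fun x => \sum_(i < m.+1) F i x) =
    (fun x => \sum_(i < m) F (widen_ord (leqnSn m) i) x) + F ord_max).
  exact: (cvgD (IH _ (fun i => cF _) x) (cF _ x)).
by apply/funext => y; rewrite big_ord_recr.
Qed.

Lemma continuous_dotvv : continuous (fun x : V => dotv x x).
Proof.
apply: continuous_sumr => i x; have c := @coord_continuous R 1 n.+1 0 i x.
exact: (cvgM c c).
Qed.

Lemma continuous_dotvl v : continuous (fun x : V => dotv x v).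
Proof.
apply: continuous_sumr => i x; have c := @coord_continuous R 1 n.+1 0 i x.
exact: (cvgM c (cvg_cst (v 0 i))).
Qed.

Lemma dimpled_continuous : continuous dimpled.
Proof.
have cd : continuous (fun x : V => Num.min 0 (dent (x 0 0))).
  move=> x; apply: (@continuous_min _ _ (fun=> 0) (fun x : V => dent (x 0 0))).
    exact: cst_continuous.
  apply: continuous_comp; first exact: coord_continuous.
  rewrite /dent; apply: cvgB; last exact: cvg_id.
  apply: cvgD; first exact: cvg_cst.
  apply: cvgM; first exact: cvg_cst.
  apply: cvgB; first exact: cvg_cst.
  by apply: cvgM; exact: cvg_id.
move=> x; exact: (cvgD cvg_id (cvgZ (cd x) (cvg_cst e0))).
Qed.

(** The displacement is vertical, so points with equal images are equal or mirror images in the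
    equatorial plane. The dimple lies strictly above that plane, so an upper point is never pushed
    onto its mirror image. *)
Lemma dimpled_inj p q : sphere p -> sphere q -> dimpled p = dimpled q -> p = q.
Proof.
move=> sp sq E.
have Ei i : i != 0 -> p 0 i = q 0 i.
  move=> i0; have := congr1 (fun x : V => x 0 i) E; rewrite /dimpled.
  by rewrite !coord_axial (negbTE i0) !mulr0 !addr0.
have E0 : p 0 0 ^+ 2 = q 0 0 ^+ 2.
  have := (sphereP p).1 sp; rewrite -((sphereP q).1 sq) /dotv.
  rewrite (bigD1 (0 : 'I_n.+1))//= [RHS](bigD1 (0 : 'I_n.+1))//=.
  rewrite (eq_bigr (fun i => q 0 i * q 0 i)) => [|i /Ei->//].
  by move/addIr; rewrite -!expr2.
suff E1 : p 0 0 = q 0 0.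
  by apply/rowP => i; have [->//|/Ei] := eqVneq i 0.
have := congr1 (fun x : V => x 0 0) E; rewrite /dimpled !coord_axial eqxx !mulr1.
move: E0; have /andP[] := sphere_coord_le 0 sp.
rewrite /dent; move: (p 0 0) (q 0 0) => a b a1 a2 ab.
have aa : a ^+ 2 <= 1 by nra.
have [//|ba] := eqVneq a b.
have : (a - b) * (a + b) = 0 by rewrite -subr_sqr ab subrr.
move/eqP; rewrite mulf_eq0 subr_eq0 (negbTE ba) /= => /eqP ab0.
by rewrite -ab; case: (leP 0 (_ - a)) => h1; case: (leP 0 (_ - b)) => h2 E1; lra.
Qed.

(** [inside] and [outside] are open, disjoint, and leave out exactly the surface. This lets the
    enclosed region be found by connectedness alone. *)
Definition inside x : Prop :=
  dotv x x < 1 /\ x 0 0 < 2 / 5 + 5 / 16 * (dotv x x - x 0 0 ^+ 2).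
Definition outside x : Prop :=
  1 < dotv x x \/ 2 / 5 + 5 / 16 * (dotv x x - x 0 0 ^+ 2) < x 0 0.

Lemma dimpled_not_inside p : sphere p -> ~ inside (dimpled p).
Proof.
move=> sp; have p1 := (sphereP p).1 sp.
have [p0|p0] := leP (p 0 0) (3 / 5).
  by rewrite dimpled_low// => -[]; rewrite p1 ltxx.
rewrite dimpled_high ?ltW// => -[_].
rewrite !dotvE !dotv_e0r dotv_e0l ebasis00 p1 !coord_axial eqxx /dent mulr1.
move: (p 0 0) => a; nra.
Qed.

Lemma dimpled_not_outside p : sphere p -> ~ outside (dimpled p).
Proof.
move=> sp; have p1 := (sphereP p).1 sp.
have /andP[l1 l2] := sphere_coord_le 0 sp.
have [p0|p0] := leP (p 0 0) (3 / 5).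
  rewrite dimpled_low// => -[]; rewrite p1 ?ltxx//.
  move: (p 0 0) p0 l1 => a; nra.
have d0 := dent_le0 (ltW p0).
(* With [d] the displacement, the squared norm of the image is [1 + d (d + 2 p_0)], and [d <= 0]. *)
have d1 : 0 <= dent (p 0 0) + 2 * p 0 0.
  by rewrite /dent; move: (p 0 0) p0 l2 => a; nra.
rewrite dimpled_high ?ltW// /outside !dotvE !dotv_e0r dotv_e0l ebasis00 p1.
rewrite coord_axial eqxx !mulr1; move: d0 d1; set d := dent _ => d0 d1 -[].
  by move: (p 0 0) d1 => a; nra.
by rewrite /d /dent; move: (p 0 0) => a; lra.
Qed.

Lemma dimpled_surj x : ~ inside x -> ~ outside x -> image_sphere dimpled x.
Proof.
move=> ni no.
have D1 : dotv x x <= 1 by rewrite leNgt; apply/negP => h; apply: no; left.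
have D2 : x 0 0 <= 2 / 5 + 5 / 16 * (dotv x x - x 0 0 ^+ 2).
  by rewrite leNgt; apply/negP => h; apply: no; right.
move: D1; rewrite le_eqVlt => /orP[/eqP D1|D1].
  exists x; first exact/sphereP.
  apply: dimpled_low; first exact/sphereP.
  move: D2; rewrite D1.
  have /andP[] := sphere_coord_le 0 ((sphereP x).2 D1).
  move: (x 0 0) => a; nra.
move: D2; rewrite le_eqVlt => /orP[/eqP D2|D2]; last by case: ni.
have r0 : x 0 0 ^+ 2 <= dotv x x by exact: ge_dotv0.
pose h := Num.sqrt (1 - (dotv x x - x 0 0 ^+ 2)).
have h2 : h ^+ 2 = 1 - (dotv x x - x 0 0 ^+ 2).
  rewrite sqr_sqrtr//; have := sqr_ge0 (x 0 0); move: D1; lra.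
have h0 : 0 <= h by exact: sqrtr_ge0.
pose p := x + (h - x 0 0) *: e0.
have p0 : p 0 0 = h by rewrite coord_axial eqxx mulr1; ring.
have sp : sphere p.
  apply/sphereP; rewrite !dotvE !dotv_e0r dotv_e0l ebasis00 -[dotv x x](subrK (x 0 0 ^+ 2)).
  move: h2; lra.
exists p => //.
(* [p] is [x] lifted vertically to the upper hemisphere. If it landed below the rim, [x] would have
   [r > 4/5] and, being on the paraboloid, height above [3/5], hence norm above 1. *)
have h35 : 3 / 5 <= h.
  rewrite leNgt; apply/negP => h35.
  have : 16 / 25 < dotv x x - x 0 0 ^+ 2 by nra.
  move: D1 D2; move: (dotv x x) (x 0 0) => a b; nra.
rewrite dimpled_high p0// /p -addrA -scalerDl.
have -> : h - x 0 0 + dent h = 0 by rewrite /dent h2; lra.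
by rewrite scale0r addr0.
Qed.

Lemma continuous_profile :
  continuous (fun x : V => x 0 0 - (2 / 5 + 5 / 16 * (dotv x x - x 0 0 ^+ 2))).
Proof.
have c0 : continuous (fun x : V => x 0 0) by move=> x; exact: coord_continuous.
move=> x; have c1 := c0 x; have c2 := @continuous_dotvv x.
apply: (cvgB c1); apply: cvgD; first exact: cvg_cst.
apply: cvgM; first exact: cvg_cst.
apply: (cvgB c2); exact: (cvgM c1 c1).
Qed.

Lemma inside_open : open inside.
Proof.
rewrite (_ : inside = [set x : V | dotv x x < 1] `&`
  [set x : V | x 0 0 - (2 / 5 + 5 / 16 * (dotv x x - x 0 0 ^+ 2)) < 0]).
  apply: openI; apply: open_comp (@open_lt _ _) => x _.
    exact: continuous_dotvv.
  exact: continuous_profile.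
by apply/seteqP; split=> x [h1 h2]; split=> //=; move: h2; rewrite /= subr_lt0.
Qed.

Lemma outside_open : open outside.
Proof.
rewrite (_ : outside = [set x : V | 1 < dotv x x] `|`
  [set x : V | 0 < x 0 0 - (2 / 5 + 5 / 16 * (dotv x x - x 0 0 ^+ 2))]).
  apply: openU; apply: open_comp (@open_gt _ _) => x _.
    exact: continuous_dotvv.
  exact: continuous_profile.
by apply/seteqP; split=> x [h|h]; [left|right|left|right] => //; move: h; rewrite /= subr_gt0.
Qed.

Lemma not_inside_outside x : inside x -> ~ outside x.
Proof. by move=> [h1 h2] [h|h]; [move: h1|move: h2]; rewrite ltNge ltW. Qed.

Lemma continuous_line x v : continuous (fun s => x + s *: v).
Proof.
move=> s; have [d _] := is_derive_add (is_derive_cst x s (1 : R))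
  (is_deriveZl v (is_derive_id s (1 : R))).
exact/differentiable_continuous/derivable1_diffP.
Qed.

Definition axial_direction x : V := (if 0 <= x 0 0 then 1 else -1) *: e0.

(** Vertical motion fixes [r]. Upwards from a height [>= 0], both the norm and the height grow;
    below the equatorial plane only the norm clause can hold, and going down increases the norm. *)
Lemma outside_axial x s : 0 <= s -> outside x ->
  outside (x + s *: axial_direction x).
Proof.
move=> s0; have r0 : x 0 0 ^+ 2 <= dotv x x by exact: ge_dotv0.
rewrite /outside /axial_direction scalerA.
rewrite !dotvE !dotv_e0r dotv_e0l ebasis00 coord_axial eqxx !mulr1.
move: (dotv x x) (x 0 0) r0 => a b r0; have s2 := sqr_ge0 s.
case: (leP 0 b) => b0 [h|h].
- by left; have := mulr_ge0 s0 b0; lra.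
- by right; lra.
- have sb : 0 <= s * - b by apply: mulr_ge0 => //; lra.
  by left; lra.
- by lra.
Qed.

(* The dimpled ball lies under the graph of a paraboloid, so its exterior is
   stable under moving away from the equatorial plane along the axis. *)
Lemma not_enclosed_outside l x :
  0 < l -> outside (l^-1 *: x) -> ~ enclosed (fun p => l *: dimpled p) x.
Proof.
move=> l0 ox [_ bx]; have ln0 : l != 0 by rewrite gt_eqF.
pose c s := x + s *: axial_direction x.
have oc s : 0 <= s -> outside (l^-1 *: c s).
  move=> s0; have lV : 0 <= l^-1 by rewrite invr_ge0 ltW.
  have := outside_axial (mulr_ge0 lV s0) ox.
  by rewrite /axial_direction mxE pmulr_rge0 ?invr_gt0// -scalerA -scalerDr.
pose ray := c @` [set s | 0 <= s].
have cray : connected ray.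
  apply: connected_continuous_connected.
    by apply/connected_intervalP => a b a0 b0 t /andP[at_ _]; exact: le_trans at_.
  by apply: continuous_subspaceT; exact: continuous_line.
have sub : ray `<=` connected_component
    (~` image_sphere (fun p => l *: dimpled p)) x.
  apply: connected_component_max cray.
    by exists 0; rewrite /= ?lexx// /c scale0r addr0.
  move=> _ [s /= s0 <-] [p sp E].
  apply: (dimpled_not_outside sp).
  by have := oc s s0; rewrite -E scalerA mulVf// scale1r.
case: bx => M [Mr /(_ (`|M| + 1))].
have M1 : M < `|M| + 1 by rewrite ltr_pwDr// ler_norm.
move=> /(_ M1) H.
have T0 : 0 <= `|M| + `|x 0 0| + 2 by rewrite !addr_ge0.
have := H (c (`|M| + `|x 0 0| + 2)) (sub _ (imageP c T0)).
move=> /(le_trans (coord_le_norm _ 0)).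
rewrite /c /axial_direction scalerA coord_axial eqxx mulr1.
have := normr_ge0 M; have := ler_norm (x 0 0); have := ler_norm (- x 0 0).
rewrite normrN; case: ifP => _; rewrite ?mulr1 ?mulrN1 ler_norml => *; lra.
Qed.

(** Off the surface, being inside is the same as not being outside, hence both an open and a closed
    condition; the component of [x] satisfies it throughout and so stays in the ball of radius
    [l]. *)
Lemma enclosed_inside l x :
  0 < l -> inside (l^-1 *: x) -> enclosed (fun p => l *: dimpled p) x.
Proof.
move=> l0 ix; have ln0 : l != 0 by rewrite gt_eqF.
have xn : ~ image_sphere (fun p => l *: dimpled p) x.
  move=> [p sp E]; apply: (dimpled_not_inside sp).
  by move: ix; rewrite -E scalerA mulVf// scale1r.
split=> //; set A := ~` _.
have cs : continuous (fun x : V => l^-1 *: x) by exact: scaler_continuous.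
have cov y : A y -> ~ outside (l^-1 *: y) -> inside (l^-1 *: y).
  move=> Ay no; apply: contrapT => ni; apply: Ay.
  have [p sp E] := dimpled_surj ni no.
  by exists p => //; rewrite E scalerA divff// scale1r.
have sub : connected_component A x `<=` [set y | inside (l^-1 *: y)].
  have : connected_component A x `&` [set y | inside (l^-1 *: y)]
      = connected_component A x.
    apply: (component_connected (A := A) (x := x)).
    - by exists x; split=> //; exact: connected_component_refl.
    - exists [set y | inside (l^-1 *: y)] => //.
      by apply: open_comp inside_open => y _; exact: cs.
    - exists (~` [set y | outside (l^-1 *: y)]).
        by rewrite closedC; apply: open_comp outside_open => y _; exact: cs.
      apply/seteqP; split=> y [Cy h]; split=> //.
        by move=> oy; exact: (not_inside_outside h).
      by apply: cov => //; exact: connected_component_sub Cy.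
  by move=> <- y [].
exists l; split; first exact: gtr0_real.
move=> M lM y /sub[yl _].
apply: le_trans (ltW lM).
rewrite /Num.Def.normr /= mx_normrE bigmax_le ?(ltW l0)// => -[i j] _ /=.
rewrite ord1 -[leRHS]gtr0_norm// -(ler_pXn2r (n := 2))// ?nnegrE//.
rewrite -!normrX !ger0_norm ?sqr_ge0// (le_trans (ge_dotv0 _ _))//.
by move: yl; rewrite !dotvE mulrA -expr2 exprVn mulrC ltr_pdivrMr ?mul1r ?exprn_gt0// => /ltW.
Qed.

End DimpledBall.

(** * The piecewise smooth structure *)

Section Pieces.
Variables (R : realType) (n : nat).
Local Notation V := 'rV[R]_n.+1.
Implicit Types (u v w x p q : V) (l s t : R).
Local Notation e0 := (@ebasis R n 0).

(* [sg = 1] is the round part, [sg = -1] the dimple. *)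
Definition piece (sg : R) : set V := [set p | sphere p /\ sg * (p 0 0 - 3 / 5) <= 0].

Lemma coord_le_enorm x i : `|x 0 i| <= enorm x.
Proof.
rewrite -(ler_pXn2r (n := 2)) ?nnegrE ?sqrtr_ge0// enorm_sqr.
by rewrite -normrX ger0_norm ?sqr_ge0// ge_dotv0.
Qed.

Lemma side_open (sg : R) : open [set x : V | sg * (x 0 0 - 3 / 5) < 0].
Proof.
have oR : open [set t : R | sg * (t - 3 / 5) < 0].
  apply: (@open_comp _ _ (fun t => sg * (t - 3 / 5)) _ _ (@open_lt _ 0)) => t _.
  have [d _] := is_derive_mul (is_derive_cst sg t (1 : R))
    (is_derive_add (is_derive_id t (1 : R)) (is_derive_cst (- (3 / 5) : R) t (1 : R))).
  exact/differentiable_continuous/derivable1_diffP.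
by apply: (@open_comp _ _ (fun x : V => x 0 0) _ _ oR) => x _;
  exact: coord_continuous.
Qed.

Lemma piece_closed (sg : R) : closed (piece sg).
Proof.
rewrite (_ : piece sg = [set x | dotv x x = 1] `&`
    ~` [set x : V | - sg * (x 0 0 - 3 / 5) < 0]).
  apply: closedI; last by rewrite closedC; exact: side_open.
  apply: (@preimage_closed _ _ (fun x : V => dotv x x) _ _ (@closed_eq _ 1)) => x _.
  exact: continuous_dotvv.
apply/seteqP; split=> x [h1 h2]; split.
- exact/sphereP.
- by move=> /=; apply/negP; rewrite -leNgt mulNr oppr_ge0.
- exact/sphereP.
- by move/negP: h2; rewrite -leNgt mulNr oppr_ge0.
Qed.

Lemma nbhs_enorm p (e : R) : 0 < e -> \forall q \near p, enorm (q - p) < e.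
Proof.
move=> e0; have c : continuous (fun q : V => dotv (q - p) (q - p)).
  move=> q; apply: (@continuous_comp _ _ _ (fun q => q - p) (fun x => dotv x x)).
    exact: (cvgB cvg_id (cvg_cst p)).
  exact: continuous_dotvv.
have e2 : dotv (p - p) (p - p) < e ^+ 2 by rewrite subrr dotv0l exprn_gt0.
have : \forall q \near p, dotv (q - p) (q - p) < e ^+ 2.
  exact: (c p [set t | t < e ^+ 2] (lt_nbhsl e2)).
apply: filterS => q qe.
by rewrite -(ltr_pXn2r (n := 2)) ?nnegrE ?sqrtr_ge0 ?(ltW e0)//
  enorm_sqr.
Qed.

(** Rim points can be moved to either side within the sphere. One side shows that they lie in the
    closure of the relative interior of a piece, the other that they are not in the relative
    interior itself. *)
Lemma edge_perturb (sg : R) p (B : set V) :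
  sg ^+ 2 = 1 -> sphere p -> p 0 0 = 3 / 5 -> nbhs p B ->
  exists q, [/\ B q, sphere q & sg * (q 0 0 - 3 / 5) < 0].
Proof.
move=> sg2 sp p0 Bp; have p1 := (sphereP p).1 sp.
have nB := near_normalize (- sg *: e0) sp (filterS (fun x Bx _ => Bx) Bp).
have [d /= d0 H] := nB.
pose s := Num.min (d / 2) (1 / 2).
have s0 : 0 < s by rewrite lt_min divr_gt0//= divr_gt0.
have sd : s < d by rewrite gt_min ltr_pdivrMr// ltr_pMr// ltr1n.
have s1 : s <= 1 / 2 by rewrite ge_min lexx orbT.
have {H} Bq : B (normalize (p + s *: (- sg *: e0))).
  by apply: H; rewrite /ball_ /= sub0r normrN gtr0_norm.
set w := p + _ in Bq *.
have wE : w 0 0 = 3 / 5 - s * sg.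
  by rewrite /w scalerA coord_axial eqxx mulr1 p0 mulrN.
have ww : dotv w w = 1 - 6 / 5 * (s * sg) + s ^+ 2.
  rewrite /w scalerA !dotvE dotv_e0r !dotv_e0l ebasis00 p1 p0.
  by transitivity (1 - 6 / 5 * (s * sg) + s ^+ 2 * sg ^+ 2); [field|rewrite sg2 mulr1].
have w0 : w != 0.
  apply/eqP => w0; move: ww; rewrite w0 dotv0l.
  have : (s * sg) ^+ 2 = s ^+ 2 by rewrite exprMn sg2 mulr1.
  move: (s * sg) => a; nra.
exists (normalize w); split => //; first exact: normalize_sphere.
have N0 := enorm_gt0 w0; have N2 := enorm_sqr w.
rewrite /normalize mxE wE; move: N0 N2; rewrite ww; move: (enorm w) => N N0 N2.
suff : sg * (3 / 5 - s * sg) < sg * (3 / 5) * N.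
  move=> H; have -> : sg * (N^-1 * (3 / 5 - s * sg) - 3 / 5) =
    (sg * (3 / 5 - s * sg) - sg * (3 / 5) * N) / N by field; rewrite gt_eqF.
  by rewrite pmulr_llt0 ?invr_gt0// subr_lt0.
have : (sg - 1) * (sg + 1) = 0 by rewrite -subr_sqr sg2 expr1n subrr.
move/eqP; rewrite mulf_eq0 subr_eq0 addr_eq0 => /orP[]/eqP E;
  move: N2; rewrite {}E => N2; nra.
Qed.

Lemma relint_piece (sg : R) : sg ^+ 2 = 1 ->
  relint (piece sg) = [set p | sphere p /\ sg * (p 0 0 - 3 / 5) < 0].
Proof.
move=> sg2; have sgn : `|sg| = 1.
  by apply/eqP; rewrite -sqrp_eq1// -normrX sg2 normr1.
apply/seteqP; split=> p [sp].
  move=> [e egt0 H]; split=> //.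
  have [_ h] : piece sg p.
    by apply: H => //; rewrite subrr /enorm dotv0l sqrtr0.
  move: h; rewrite le_eqVlt => /orP[/eqP h|//]; exfalso.
  have p0 : p 0 0 = 3 / 5.
    move/eqP: h; rewrite mulf_eq0 subr_eq0 => /orP[/eqP E|/eqP//].
    by move: sg2; rewrite E expr0n /= => /eqP; rewrite eq_sym oner_eq0.
  have sgN : (- sg) ^+ 2 = 1 by rewrite sqrrN.
  have [q [qe sq]] := edge_perturb sgN sp p0 (nbhs_enorm p egt0).
  have [_] := H q sq qe.
  by rewrite mulNr oppr_lt0 leNgt => /negP.
(* The height is 1-Lipschitz, so the height difference from [p] to the rim serves as radius. *)
move=> h; split=> //; exists (- (sg * (p 0 0 - 3 / 5))); first by rewrite oppr_gt0.
move=> q sq qp; split=> //.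
have H : sg * (q 0 0 - p 0 0) <= enorm (q - p).
  apply: le_trans (coord_le_enorm _ 0); rewrite !mxE.
  by rewrite -[leRHS]mul1r -sgn -normrM ler_norm.
by rewrite -(subrKA (p 0 0)) mulrDr; lra.
Qed.

Lemma closure_relint_piece (sg : R) : sg ^+ 2 = 1 ->
  piece sg = closure (relint (piece sg)).
Proof.
move=> sg2; apply/seteqP; split.
  move=> p [sp]; rewrite le_eqVlt => /orP[/eqP h|h]; last first.
    by apply: subset_closure; rewrite relint_piece.
  have p0 : p 0 0 = 3 / 5.
    move/eqP: h; rewrite mulf_eq0 subr_eq0 => /orP[/eqP E|/eqP//].
    by move: sg2; rewrite E expr0n /= => /eqP; rewrite eq_sym oner_eq0.
  move=> B Bp; have [q [Bq sq qs]] := edge_perturb sg2 sp p0 Bp.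
  by exists q; split=> //; rewrite relint_piece.
rewrite [X in _ `<=` X](closure_id _).1; last exact: piece_closed.
by apply: closureS; rewrite relint_piece// => p [sp /ltW].
Qed.

Definition piece_sign (i : 'I_2) : R := (-1) ^+ i.

Lemma piece_sign_sqr i : piece_sign i ^+ 2 = 1.
Proof. exact: sqrr_sign. Qed.

Definition piece_dent (i : 'I_2) : R -> R := if i == 0 then cst 0 else @dent R.

Lemma dent_derive1 t : derive1 (@dent R) t = - (5 / 8) * t - 1.
Proof.
rewrite derive1E; apply: derive_val.
have := is_derive_add (is_derive_add (is_derive_cst (2 / 5 : R) t (1 : R))
  (is_derive_mul (is_derive_cst (5 / 16 : R) t (1 : R))
    (is_derive_add (is_derive_cst (1 : R) t (1 : R))
      (is_deriveN (is_derive_exp 2 (is_derive_id t (1 : R)))))))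
  (is_deriveN (is_derive_id t (1 : R))).
by move=> H; apply: (is_derive_eq H); rewrite /cst /=; field.
Qed.

Lemma smooth1_dent : smooth1 (@dent R).
Proof.
pose S := [set f : R -> R | exists p : {poly R}, f = horner p].
have SE : S `<=` smooth1 (R := R).
  apply: smooth1_closed => f [p ->].
  by exists (horner p^`()); [exists p^`()|move=> x; exact: is_derive_poly].
apply: SE; exists ((2 / 5)%:P + (5 / 16)%:P * (1 - 'X ^+ 2) - 'X).
by apply/funext => t; rewrite /dent !hornerE.
Qed.

Lemma smooth1_cst (c : R) : smooth1 (cst c).
Proof.
have SE : [set f | exists c : R, f = cst c] `<=` smooth1 (R := R).
  apply: smooth1_closed => f [d ->].
  by exists (cst 0); [exists 0|move=> x; exact: is_derive_cst].
by apply: SE; exists c.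
Qed.

Lemma smooth1_piece_dent i : smooth1 (piece_dent i).
Proof.
by rewrite /piece_dent; case: ifP => _; [exact: smooth1_cst|exact: smooth1_dent].
Qed.

Lemma piece_dent_derive1 i t : derive1 (piece_dent i) t =
  if i == 0 then 0 else - (5 / 8) * t - 1.
Proof.
rewrite /piece_dent; case: ifP => _; last exact: dent_derive1.
by rewrite derive1_cst.
Qed.

Lemma I2P (i : 'I_2) : i = 0 \/ i = 1.
Proof. by case: i => -[|[|//]] H; [left|right]; exact: val_inj. Qed.

Lemma dimpled_piece i p : piece (piece_sign i) p ->
  dimpled p = p + piece_dent i (p 0 0) *: e0.
Proof.
rewrite /piece_sign /piece_dent => -[sp].
have [->|->] := I2P i; rewrite /= ?expr0 ?expr1 => h.
  by rewrite scale0r addr0 dimpled_low//; lra.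
by rewrite dimpled_high//; lra.
Qed.

Lemma dimpled_pc2_decomp l : 0 < l ->
  pc2_decomp (fun p => l *: dimpled p) (fun i : 'I_2 => piece (piece_sign i)).
Proof.
move=> l0; split.
- move=> q sq; have [h|h] := leP (q 0 0) (3 / 5).
    by exists 0; split=> //; rewrite /piece_sign expr0; lra.
  by exists 1; split=> //; rewrite /piece_sign expr1; lra.
- by move=> i; split; [move=> p []|exact: piece_closed].
- by move=> i; apply: closure_relint_piece; exact: piece_sign_sqr.
- move=> i j ij; rewrite !relint_piece ?piece_sign_sqr//.
  rewrite -subset0 => p [[_ h1] [_ h2]]; move: ij h1 h2.
  rewrite /piece_sign; have [->|->] := I2P i; have [->|->] := I2P j => //= _;
    rewrite ?expr0 ?expr1 => *; lra.
- move=> i; exists setT, (profile 0 ( *:%R l) (piece_dent i) (l *: e0)).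
  have dL : derivative_of_itself (fun x : V => l *: x).
    split=> [x|x v]; first exact: scaler_continuous.
    exact: (is_deriveZ l (is_derive_id x v)).
  have sd := @smooth1_piece_dent i.
  split=> //; first exact: openT.
  + by case: (profile_Cinf 0 (l *: e0) setT dL sd 2).
  + move=> p pi; rewrite (dimpled_piece pi) /profile add0r scalerDr scalerA.
    by rewrite mulrC -scalerA.
  + move=> p v [sp pi] vp vn0.
    rewrite (@derive_val _ _ _ _ _ _ _ (is_derive_profile 0 (l *: e0) p v dL sd)).
    rewrite /profile addr0 piece_dent_derive1 scalerA scalerA mulrC -scalerA -scalerDr.
    rewrite scaler_eq0 (gt_eqF l0) /=; apply: contra vn0 => /eqP E.
    have E0 := congr1 (fun x : V => x 0 0) E; rewrite coord_axial eqxx mulr1 mxE in E0.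
    (* On the dimple the axial part of the equation is [- (5/8) p_0 v_0 = 0], and [p_0 >= 3/5]
       there. *)
    have v0 : v 0 0 = 0.
      move: E0 pi; rewrite /axial_coord /piece_sign; have [->|->] := I2P i => /=.
        by rewrite mul0r addr0.
      rewrite expr1 => E0 pi.
      have : p 0 0 * v 0 0 = 0 by lra.
      by move/eqP; rewrite mulf_eq0 => /orP[/eqP p0|/eqP//]; exfalso; lra.
    by move: E; rewrite v0 mulr0 scale0r addr0 => ->.
Qed.

End Pieces.

(** * The integrand, its Cahn-Hoffman map and the curvature of the surface *)

Section Shrinker.
Variables (R : realType) (n : nat).
Local Notation V := 'rV[R]_n.+1.
Implicit Types (u v w x p q nu : V) (l s t : R).
Local Notation e0 := (@ebasis R n 0).

(* [6/5 s - 4/(5 s)] is the support function of the paraboloid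
   [x0 = 2/5 + 5/16 r^2] at the normal of axial coordinate [s]; it is positive
   for [s ^+ 2 > 2 / 3], hence on the whole range [s >= 5 / 6] of the step. *)
Definition support (s : R) : R :=
  1 + (6 / 5 * s - 4 / 5 * s^-1 - 1) * smooth_step (5 / 6) (7 / 8) s.

Definition gam x : R := support (x 0 0).

Let a0 : (0 : R) < 5 / 6. Proof. by lra. Qed.
Let ab : (5 / 6 : R) < 7 / 8. Proof. by lra. Qed.

Lemma smooth1_support : smooth1 support.
Proof. exact: smooth_step_profile a0 ab _ _. Qed.

Lemma support_low s : s <= 5 / 6 -> support s = 1.
Proof. by move=> h; rewrite /support smooth_step0// mulr0 addr0. Qed.

Lemma support_high s : 7 / 8 <= s -> support s = 6 / 5 * s - 4 / 5 * s^-1.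
Proof. by move=> h; rewrite /support smooth_step1//; ring. Qed.

Lemma support_gt0 s : 0 < support s.
Proof.
have [h|h] := leP s (5 / 6); first by rewrite support_low.
have /andP[c0 c1] := smooth_step_itv ab s.
have f0 : 0 < 6 / 5 * s - 4 / 5 * s^-1.
  have -> : 6 / 5 * s - 4 / 5 * s^-1 = (6 / 5 * s ^+ 2 - 4 / 5) / s.
    by field; rewrite gt_eqF// (lt_trans a0).
  apply: divr_gt0; last exact: lt_trans a0 h.
  by nra.
rewrite /support; move: (smooth_step _ _ s) (_ - _ * _) c0 c1 f0 => c f c0 c1 f0.
have [cE|cE] := eqVneq c 0; first by rewrite cE; lra.
have cgt : 0 < c by rewrite lt_neqAle eq_sym cE.
have := mulr_gt0 cgt f0; lra.
Qed.

Lemma smooth_on_sphere_gam : smooth_on_sphere gam.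
Proof.
exists setT, gam; split=> //; first exact: openT.
have -> : gam = profile (0 : R) (fun _ => 0) support 1.
  by apply/funext => x; rewrite /profile !add0r [_ *: _]mulr1.
by apply: profile_Cinf; [exact: derivative_of_itself0|exact: smooth1_support].
Qed.

Lemma cahn_hoffman_gam_low nu : sphere nu -> nu 0 0 < 5 / 6 ->
  cahn_hoffman gam nu = nu.
Proof.
move=> snu h; rewrite cahn_hoffman_axial//; last exact: smooth1_support.
have -> : derive1 support (nu 0 0) = 0.
  rewrite derive1E; apply: derive_val.
  apply: (near_eq_is_derive _ (is_derive_cst (1 : R) (nu 0 0) (1 : R))).
  by apply: filterS (lt_nbhsl h) => s sl; rewrite support_low// ltW.
by rewrite scale0r add0r support_low ?ltW// mulr0 subr0 scale1r.
Qed.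

Lemma cahn_hoffman_gam_high nu : sphere nu -> 7 / 8 < nu 0 0 ->
  cahn_hoffman gam nu =
    (6 / 5 + 4 / 5 * (nu 0 0) ^- 2) *: e0 - (8 / 5 / nu 0 0) *: nu.
Proof.
move=> snu h; rewrite cahn_hoffman_axial//; last exact: smooth1_support.
have n0 : nu 0 0 != 0 by rewrite gt_eqF//; lra.
have -> : derive1 support (nu 0 0) = 6 / 5 + 4 / 5 * (nu 0 0) ^- 2.
  have d1 := is_derive_mul (is_derive_cst (6 / 5 : R) (nu 0 0) (1 : R))
    (is_derive_id (nu 0 0) (1 : R)).
  have d2 := is_derive_mul (is_derive_cst (- (4 / 5) : R) (nu 0 0) (1 : R))
    (is_derive_inv (f := id) n0 (is_derive_id (nu 0 0) (1 : R))).
  have E : \forall s \near nu 0 0, 6 / 5 * s + - (4 / 5) * s^-1 = support s.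
    by apply: filterS (lt_nbhsr h) => s /ltW /support_high ->; rewrite mulNr.
  have D : is_derive (nu 0 0) 1 (fun s => 6 / 5 * s + - (4 / 5) * s^-1)
      (6 / 5 + 4 / 5 * (nu 0 0) ^- 2).
    apply: (is_derive_eq (is_derive_add d1 d2)).
    by rewrite /cst mulr1 mulr0 addr0 mulr0 addr0 mulr1 mulrNN exprVn.
  by rewrite derive1E; have [_ ->] := near_eq_is_derive E D.
rewrite -(scaleNr (8 / 5 / nu 0 0)) support_high ?(ltW h)//.
by congr (_ + _ *: _); move: (nu 0 0) n0 => s s0; field.
Qed.

(** The gradient of [x0 - 5/16 r^2] at [dimpled p], which has the same horizontal part as [p]. Its
    axial coordinate is 1, so that of the unit normal is the inverse of its norm. *)
Definition dimple_normal p : V := (1 + 5 / 8 * p 0 0) *: e0 - (5 / 8) *: p.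

Definition outer_normal p : V :=
  if p 0 0 < 3 / 5 then p else normalize (dimple_normal p).

Lemma dimple_normal0 p : dimple_normal p 0 0 = 1.
Proof. by rewrite !mxE !eqxx mulr1 addrK. Qed.

Lemma dimple_normal_sqr p : sphere p ->
  dotv (dimple_normal p) (dimple_normal p) = 1 + 25 / 64 * (1 - p 0 0 ^+ 2).
Proof.
move=> /sphereP p1; rewrite !dotvE p1 !dotv_e0l dotv_e0r ebasis00.
by field.
Qed.

Lemma dimple_normal_neq0 p : dimple_normal p != 0.
Proof.
apply/eqP => /(congr1 (fun x : V => x 0 0)); rewrite dimple_normal0 mxE.
by move/eqP; rewrite oner_eq0.
Qed.

Lemma outer_normal_sphere p : sphere p -> sphere (outer_normal p).
Proof.
rewrite /outer_normal; case: ifP => // _ _.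
exact/normalize_sphere/dimple_normal_neq0.
Qed.

Lemma cahn_hoffman_outer_normal p : sphere p -> p 0 0 != 3 / 5 ->
  cahn_hoffman gam (outer_normal p) = dimpled p.
Proof.
move=> sp; have := outer_normal_sphere sp.
rewrite /outer_normal; case: ltP => h snu p0.
  by rewrite cahn_hoffman_gam_low ?dimpled_low ?ltW//; lra.
have N2 := enorm_sqr (dimple_normal p); rewrite dimple_normal_sqr// in N2.
have N0 := enorm_gt0 (dimple_normal_neq0 p).
have s0 : normalize (dimple_normal p) 0 0 = (enorm (dimple_normal p))^-1.
  by rewrite mxE dimple_normal0 mulr1.
(* Above the rim the squared norm is at most [5/4], which is less than [(8/7)^2]. *)
have s1 : 7 / 8 < normalize (dimple_normal p) 0 0.
  rewrite s0 -(div1r (enorm _)) ltr_pdivlMr//; move: N0 N2 h {p0 s0 snu}.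
  move: (enorm _) (p 0 0) => N a N0 N2 h; nra.
rewrite cahn_hoffman_gam_high// s0 invrK /normalize scalerA.
move: N0 N2 {s0 s1 snu}; move: (enorm _) => N N0 N2.
have -> : 8 / 5 * N * N^-1 = 8 / 5 by rewrite mulfK ?gt_eqF.
have -> : N^-1 ^- 2 = 1 + 25 / 64 * (1 - p 0 0 ^+ 2) by rewrite exprVn invrK.
rewrite dimpled_high// /dimple_normal /dent; apply/rowP => j; rewrite !mxE !eqxx /=.
by field.
Qed.

Lemma outer_normal_tangent i p v : sphere p -> piece_sign R i * (p 0 0 - 3 / 5) < 0 ->
  dotv v p = 0 ->
  dotv (v + (derive1 (piece_dent i) (p 0 0) * v 0 0) *: e0) (outer_normal p) = 0.
Proof.
move=> sp; rewrite /piece_sign /outer_normal piece_dent_derive1.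
have [->|->] := I2P i; rewrite /= ?expr0 ?expr1 => h vp.
  by rewrite ifT ?mul0r ?scale0r ?addr0//; lra.
rewrite ifF; last by apply/negbTE; rewrite -leNgt; lra.
rewrite /normalize dotvZr; apply/eqP; rewrite mulf_eq0; apply/orP; right; apply/eqP.
rewrite /dimple_normal !dotvE vp !dotv_e0r !dotv_e0l ebasis00.
by field.
Qed.

Lemma regptP p : regpt (fun i => piece (piece_sign R i)) p ->
  exists i, [/\ sphere p, piece_sign R i * (p 0 0 - 3 / 5) < 0 & p 0 0 != 3 / 5].
Proof.
move=> [i]; rewrite relint_piece ?piece_sign_sqr// => -[sp h]; exists i.
split=> //; apply/eqP => p0; move: h; rewrite p0 subrr mulr0 ltxx//.
Qed.

Lemma near_piece i p : piece_sign R i * (p 0 0 - 3 / 5) < 0 ->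
  nbhs p [set q : V | piece_sign R i * (q 0 0 - 3 / 5) < 0].
Proof. by move=> h; apply: open_nbhs_nbhs; split=> //; exact: side_open. Qed.

Let scale_comb l w c u : l *: (w + c *: u) = l *: w + c *: (l *: u).
Proof. by rewrite scalerDr !scalerA mulrC. Qed.

Lemma sD_dimpled l i p v : sphere p -> piece_sign R i * (p 0 0 - 3 / 5) < 0 ->
  sD (fun q => l *: dimpled q) p v =
    l *: (tproj p v + (derive1 (piece_dent i) (p 0 0) * tproj p v 0 0) *: e0).
Proof.
move=> sp h; rewrite (@sD_profile _ _ p v _ l (@piece_dent R i) (l *: e0)) ?scale_comb//.
- exact: smooth1_piece_dent.
- apply: filterS (near_piece h) => q /ltW qi sq.
  by rewrite (@dimpled_piece _ _ i)// scale_comb.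
Qed.

Lemma sD_cahn_hoffman i p v : sphere p -> piece_sign R i * (p 0 0 - 3 / 5) < 0 ->
  sD (fun q => cahn_hoffman gam (outer_normal q)) p v =
    tproj p v + (derive1 (piece_dent i) (p 0 0) * tproj p v 0 0) *: e0.
Proof.
move=> sp h; rewrite (@sD_profile _ _ p v _ 1 (@piece_dent R i) e0) ?scale1r//.
- exact: smooth1_piece_dent.
- apply: filterS (near_piece h) => q qi sq.
  rewrite cahn_hoffman_outer_normal//.
    by rewrite scale1r (@dimpled_piece _ _ i)//; split=> //; exact: ltW.
  by apply/eqP => q0; move: qi; rewrite /= q0 subrr mulr0 ltxx.
Qed.

Lemma aniso_mc_dimpled l i p : (0 < n)%N -> 0 < l -> sphere p ->
  piece_sign R i * (p 0 0 - 3 / 5) < 0 ->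
  aniso_mc gam (fun q => l *: dimpled q) outer_normal p = - l^-1.
Proof.
move=> n0 l0 sp h; set c := derive1 (piece_dent i) (p 0 0).
(* The differential of [p + piece_dent i p_0 e0], which describes both the surface and its
   Cahn-Hoffman field near [p]. *)
pose M : 'M[R]_n.+1 := 1%:M + c *: delta_mx 0 0.
have ME w : w *m M = w + (c * w 0 0) *: e0.
  rewrite /M mulmxDr mulmx1 -scalemxAr -scalerA; congr (_ + _ *: _).
  apply/rowP => j; rewrite !mxE (bigD1 0)//= big1 ?addr0 => [|k k0].
    by rewrite !mxE !eqxx.
  by rewrite mxE (negbTE k0) mulr0.
apply: (@aniso_mc_shrinker _ _ _ _ _ _ _ M) => //; rewrite ?gt_eqF//.
- exact: outer_normal_sphere.
- by move=> v; rewrite ME (@sD_dimpled l i).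
- by move=> v; rewrite ME (@sD_cahn_hoffman i).
- by move=> v; rewrite ME (@outer_normal_tangent i)// dotv_tproj.
- move=> v vp; rewrite ME => E.
  have E0 := congr1 (fun x : V => x 0 0) E; rewrite coord_axial eqxx mulr1 mxE in E0.
  have v0 : v 0 0 = 0.
    move: E0 h; rewrite /c piece_dent_derive1 /piece_sign; have [->|->] := I2P i => /=.
      by rewrite mul0r addr0.
    rewrite expr1 => E0 h.
    have : p 0 0 * v 0 0 = 0 by lra.
    by move/eqP; rewrite mulf_eq0 => /orP[/eqP p0|/eqP//]; exfalso; lra.
  by move: E; rewrite v0 mulr0 scale0r addr0.
Qed.

End Shrinker.

(** * Non-convexity, outward normals, the flow and the Wulff shape *)

Section Conclusion.
Variables (R : realType) (n : nat).
Local Notation V := 'rV[R]_n.+1.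
Implicit Types (u v w x p q nu : V) (l s t : R).
Local Notation e0 := (@ebasis R n 0).
Local Notation e1 := (@ebasis R n ord_max).
Local Notation gam := (@gam R n).

(** On the slice [x_0 = 1] the unit vector has axial coordinate [1 / |x|], in the dimple range as
    [5/4 < (8/7)^2]. The result is visibly concave in the horizontal variables. *)
Lemma homog_ext_gam x : x 0 0 = 1 -> dotv x x <= 5 / 4 ->
  homog_ext gam x = 6 / 5 - 4 / 5 * dotv x x.
Proof.
move=> x0 xx; have xn0 : x != 0.
  apply/eqP => x00; move: x0; rewrite x00 mxE => /esym/eqP.
  by rewrite oner_eq0.
have := enorm_gt0 xn0; have := enorm_sqr x.
rewrite /homog_ext /gam /normalize mxE x0 mulr1.
move: (enorm x) => N N2 N0; rewrite -{}N2 in xx *.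
rewrite support_high ?invrK; first by field; rewrite gt_eqF.
by rewrite -(div1r N) ler_pdivlMr//; nra.
Qed.

Lemma gam_not_convex : (0 < n)%N -> ~ convex_integrand gam.
Proof.
move=> n0; have m0 : (ord_max == 0 :> 'I_n.+1) = false by rewrite -val_eqE /= gtn_eqF.
have e11 : dotv e1 e1 = 1 by rewrite dotv_ebasis mxE !eqxx.
have e10 : e1 0 0 = 0 by rewrite mxE eq_sym m0 andbF.
(* Both endpoints have squared norm [5/4] and value [1/5], but the midpoint [e0] has value [2/5]. *)
move=> /(_ (e0 + (1 / 2) *: e1) (e0 - (1 / 2) *: e1) (1 / 2)).
have -> : (1 - 1 / 2) *: (e0 + (1 / 2) *: e1) + (1 / 2) *: (e0 - (1 / 2) *: e1) = e0.
  by apply/rowP => j; rewrite !mxE; field.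
have D s : dotv (e0 + s *: e1) (e0 + s *: e1) = 1 + s ^+ 2.
  by rewrite !dotvE e11 !dotv_e0l dotv_e0r ebasis00 e10; ring.
have C s : (e0 + s *: e1) 0 0 = 1 by rewrite mxE ebasis00 mxE e10 mulr0 addr0.
rewrite -(scaleNr (1 / 2) e1) !homog_ext_gam ?C ?D ?dotv_e0l ?ebasis00//; lra.
Qed.

(** Moving inwards by [s] reduces the gap to the paraboloid by at most [s + 5/8 s], which is less
    than [2 s]. *)
Lemma normal_segment_low p s : sphere p -> p 0 0 < 3 / 5 -> 0 < s < 1 ->
  2 * s < 2 / 5 + 5 / 16 * (1 - p 0 0 ^+ 2) - p 0 0 ->
  inside (p - s *: p) /\ outside (p + s *: p).
Proof.
move=> sp p0 /andP[s0 s1]; have /andP[p1 p2] := sphere_coord_le 0 sp.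
rewrite /inside /outside !dotvE ((sphereP p).1 sp) !mxE.
move: (p 0 0) p0 p1 p2 => a p0 p1 p2 h.
have aa : 0 <= 1 - a ^+ 2 by nra.
have saa : 0 <= s ^+ 2 * (1 - a ^+ 2) by rewrite mulr_ge0 ?sqr_ge0.
have sa : 0 <= s * (1 + a) by rewrite mulr_ge0//; lra.
have sb : 0 <= s * a ^+ 2 by rewrite mulr_ge0 ?sqr_ge0// ltW.
by split; [split; nra|left; nra].
Qed.

(** The bound [1/5] gives [s^2 <= s/5], enough for the linear decrease of the squared norm along the
    inward normal to beat its quadratic term, uniformly on the dimple. *)
Lemma normal_segment_high p s : sphere p -> 3 / 5 < p 0 0 -> 0 < s < 1 / 5 ->
  inside (dimpled p - s *: dimple_normal p) /\
  outside (dimpled p + s *: dimple_normal p).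
Proof.
move=> sp p0 /andP[s0 s1]; have /andP[_ p2] := sphere_coord_le 0 sp.
have mm := dimple_normal_sqr sp; have m0 := dimple_normal0 p.
have YE : dimpled p = p + dent (p 0 0) *: e0 by rewrite dimpled_high// ltW.
have Y0 : dimpled p 0 0 = 2 / 5 + 5 / 16 * (1 - p 0 0 ^+ 2).
  by rewrite YE coord_axial eqxx mulr1 /dent; ring.
have YY : dotv (dimpled p) (dimpled p) =
    (2 / 5 + 5 / 16 * (1 - p 0 0 ^+ 2)) ^+ 2 + (1 - p 0 0 ^+ 2).
  rewrite YE !dotvE !dotv_e0r dotv_e0l ebasis00 ((sphereP p).1 sp) /dent.
  by field.
have Ym : dotv (dimpled p) (dimple_normal p) = 2 / 5 - 5 / 16 * (1 - p 0 0 ^+ 2).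
  rewrite YE /dimple_normal !dotvE !dotv_e0r !dotv_e0l ebasis00 ((sphereP p).1 sp) /dent.
  by field.
have E t : dotv (dimpled p + t *: dimple_normal p) (dimpled p + t *: dimple_normal p) =
   (2 / 5 + 5 / 16 * (1 - p 0 0 ^+ 2)) ^+ 2 + (1 - p 0 0 ^+ 2)
   + 2 * t * (2 / 5 - 5 / 16 * (1 - p 0 0 ^+ 2))
   + t ^+ 2 * (1 + 25 / 64 * (1 - p 0 0 ^+ 2)).
  move: mm YY Ym; move: (dimple_normal p) (dimpled p) => m Y mm YY Ym.
  by rewrite !dotvE mm YY (dotvC m) Ym; ring.
have E0 t : (dimpled p + t *: dimple_normal p) 0 0 =
    2 / 5 + 5 / 16 * (1 - p 0 0 ^+ 2) + t.
  by rewrite mxE Y0 mxE m0 mulr1.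
rewrite /inside /outside -(scaleNr s (dimple_normal p)) !E !E0.
have : 0 <= 1 - p 0 0 ^+ 2 < 16 / 25 by apply/andP; split; nra.
move: (1 - p 0 0 ^+ 2) => r /andP[r0 r1].
have sr : 0 <= s * r by rewrite mulr_ge0// ltW.
have ss : s ^+ 2 <= s / 5 by nra.
have ssr : s ^+ 2 * r <= s * r / 5 by nra.
split; [split|right].
- have : (2 / 5 + 5 / 16 * r) ^+ 2 + r < 1 by nra.
  have : s * r <= s * (16 / 25) by nra.
  lra.
- have : 0 <= s ^+ 2 * r by rewrite mulr_ge0 ?sqr_ge0.
  lra.
- lra.
Qed.

Lemma dimpled_outward_normal l i p : 0 < l -> sphere p ->
  piece_sign R i * (p 0 0 - 3 / 5) < 0 ->
  outward_normal (fun q => l *: dimpled q) p (outer_normal p).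
Proof.
move=> l0 sp h; have ln0 : l != 0 by rewrite gt_eqF.
split.
- exact: outer_normal_sphere.
- move=> v vp; rewrite (@sD_dimpled _ _ l i)// dotvZl tproj_id//.
  by rewrite outer_normal_tangent// mulr0.
suff [e e0 H] : exists2 e : R, 0 < e & forall s, 0 < s < e ->
    inside (dimpled p - s *: outer_normal p) /\
    outside (dimpled p + s *: outer_normal p).
  exists (l * e); first exact: mulr_gt0.
  move=> s /andP[s0 sle].
  have sl : 0 < l^-1 * s < e.
    by rewrite mulr_gt0 ?invr_gt0//= mulrC ltr_pdivrMr// mulrC.
  have [hi ho] := H _ sl.
  have hE u : l^-1 *: (l *: dimpled p + s *: u) = dimpled p + (l^-1 * s) *: u.
    by rewrite scalerDr !scalerA mulVf// scale1r.
  split; first by apply: enclosed_inside => //; rewrite -scalerN hE scalerN.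
  by apply: not_enclosed_outside => //; rewrite hE.
rewrite /outer_normal; have [p0|p0] := ltP (p 0 0) (3 / 5).
  pose d := 2 / 5 + 5 / 16 * (1 - p 0 0 ^+ 2) - p 0 0.
  have d0 : 0 < d.
    have /andP[p1 p2] := sphere_coord_le 0 sp; rewrite /d.
    by move: (p 0 0) p0 p1 p2 => a p0 p1 p2; nra.
  exists (Num.min 1 (d / 2)); first by rewrite lt_min ltr01 divr_gt0.
  move=> s /andP[s0]; rewrite lt_min => /andP[s1 s2].
  rewrite dimpled_low ?ltW//; apply: normal_segment_low => //.
    by rewrite s0.
  by move: s2; rewrite /d ltr_pdivlMr// mulrC.
have p0' : 3 / 5 < p 0 0.
  rewrite lt_neqAle p0 andbT; apply/eqP => p0E; move: h.
  by rewrite -p0E subrr mulr0 ltxx.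
have N0 := enorm_gt0 (dimple_normal_neq0 p).
(* The bound [1/5] is for the normal of axial coordinate 1; the norm converts it to the unit
   normal. *)
exists (enorm (dimple_normal p) / 5); first by rewrite divr_gt0.
move=> s /andP[s0 s1]; rewrite /normalize scalerA.
apply: normal_segment_high => //; rewrite divr_gt0//=.
by rewrite ltr_pdivrMr// mulrC mul1r; move: s1; rewrite mulrC.
Qed.

(** The solution of [l' = - 1 / l] that becomes extinct at time 0. *)
Definition scale_at t : R := Num.sqrt (- 2 * t).

Lemma scale_at_gt0 t : t < 0 -> 0 < scale_at t.
Proof. by move=> t0; rewrite sqrtr_gt0; lra. Qed.

Lemma is_derive_scale_at t : t < 0 -> is_derive t 1 scale_at (- (scale_at t)^-1).
Proof.
move=> t0; have m0 : 0 < - 2 * t by lra.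
have d1 := is_derive_mul (is_derive_cst (- 2 : R) t (1 : R)) (is_derive_id t (1 : R)).
have ds := is_derive1_sqrt m0.
have D := is_derive_comp1 (k := fun s : R => - 2 * s) ds d1.
apply: (is_derive_eq D); rewrite /cst /scale_at.
by have := scale_at_gt0 t0; rewrite /scale_at => s0; field; rewrite gt_eqF.
Qed.

Lemma aniso_mcf_dimpled : (0 < n)%N ->
  aniso_mcf gam (- 1) 0 (fun t p => scale_at t *: dimpled p).
Proof.
move=> n0 t /andP[_ t0]; have l0 := scale_at_gt0 t0.
have ln0 : scale_at t != 0 by rewrite gt_eqF.
split.
  split.
    apply: continuous_subspaceT => x.
    have c := @dimpled_continuous R n x.
    exact: (cvgZ (cvg_cst (scale_at t)) c).
  by move=> p q sp sq /(scalerI ln0); exact: dimpled_inj.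
exists 2%N, (fun i => piece (piece_sign R i)), (@outer_normal R n); split.
- exact: dimpled_pc2_decomp.
- by move=> p /regptP[i [sp h _]]; exact: (dimpled_outward_normal (i := i)).
- exists (@dimpled R n); split.
    by apply: continuous_subspaceT; exact: dimpled_continuous.
  by move=> p /regptP[i [sp h p0]]; rewrite cahn_hoffman_outer_normal.
- move=> p /regptP[i [sp h p0]].
  have D := is_deriveZl (dimpled p) (is_derive_scale_at t0).
  split; first by case: D.
  rewrite derive1E (@derive_val _ _ _ _ _ _ _ D).
  by rewrite (aniso_mc_dimpled (i := i))// cahn_hoffman_outer_normal.
Qed.

Lemma self_similar_shrinking_dimpled :
  self_similar_shrinking (- 1) 0 (fun t p => scale_at t *: dimpled (p : V)).
Proof.
exists (@dimpled R n), 0, scale_at; split.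
- by move=> t /andP[_ t0]; exact: scale_at_gt0.
- move=> s t _ st t0; rewrite ltr_sqrt; lra.
- by move=> t p _ _; rewrite addr0.
Qed.

Lemma wulff_body_closed (g : V -> R) : closed (wulff_body g).
Proof.
rewrite (_ : wulff_body g =
    \bigcap_(nu in sphere (R := R) (n := n)) [set X : V | dotv X nu <= g nu]).
  apply: closed_bigI => nu _.
  apply: (@preimage_closed _ _ (fun x : V => dotv x nu) _ _ (@closed_le _ (g nu))).
  move=> x _; exact: continuous_dotvl.
by apply/seteqP; split.
Qed.

Lemma wulff_body_midpoint (g : V -> R) u v : wulff_body g u -> wulff_body g v ->
  wulff_body g ((1 / 2) *: (u + v)).
Proof.
by move=> Ku Kv nu sn; have := Ku nu sn; have := Kv nu sn; rewrite !dotvE; lra.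
Qed.

(* A translated and rescaled Wulff body containing two antipodal points of the
   rim contains the middle of the dimple's rim disc, which lies outside the
   dimpled ball; the vertical ray from there never meets the surface, so it
   would stay in the Wulff body, which is bounded above. *)
Lemma dimpled_not_wulff (g : V -> R) l : (0 < n)%N -> 0 < l ->
  ~ exists (r : R) (c : V), 0 < r /\
    image_sphere (fun p => l *: dimpled p) = [set r *: w + c | w in wulff_shape g].
Proof.
move=> n0 l0 [r [c [r0 E]]]; have ln0 : l != 0 by rewrite gt_eqF.
have rn0 : r != 0 by rewrite gt_eqF.
have m0 : (ord_max == 0 :> 'I_n.+1) = false by rewrite -val_eqE /= gtn_eqF.
have e11 : dotv e1 e1 = 1 by rewrite dotv_ebasis mxE !eqxx.
have e10 : e1 0 0 = 0 by rewrite mxE eq_sym m0 andbF.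
have rim s : s ^+ 2 = 16 / 25 -> exists2 w, wulff_body g w &
    r *: w + c = l *: ((3 / 5) *: e0 + s *: e1).
  move=> s2; set p := _ + _.
  have p0 : p 0 0 = 3 / 5 by rewrite mxE mxE ebasis00 mxE e10; ring.
  have sp : sphere p.
    apply/sphereP; rewrite !dotvE e11 !dotv_e0l dotv_e0r ebasis00 e10.
    by transitivity (9 / 25 + s ^+ 2); [field|rewrite s2; field].
  have : image_sphere (fun p => l *: dimpled p) (l *: p).
    by exists p => //; rewrite dimpled_low// p0.
  rewrite E => -[w [Kw _] <-]; exists w => //.
  by move: Kw; rewrite -(closure_id _).1//; exact: wulff_body_closed.
have [w1 K1 E1] := rim (4 / 5) ltac:(by field).
have [w2 K2 E2] := rim (- (4 / 5)) ltac:(by field).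
have := wulff_body_midpoint K1 K2; set w := _ *: _ => Kw.
have wE : r *: w + c = l *: ((3 / 5) *: e0).
  transitivity ((1 / 2) *: ((r *: w1 + c) + (r *: w2 + c))).
    by apply/rowP => j; rewrite !mxE; field.
  by rewrite E1 E2; apply/rowP => j; rewrite !mxE; field.
pose ray := (fun s => w + s *: e0) @` [set s | 0 <= s].
have cray : connected ray.
  apply: connected_continuous_connected.
    by apply/connected_intervalP => a b a0 b0 t /andP[at_ _]; exact: le_trans at_.
  by apply: continuous_subspaceT; exact: continuous_line.
(* A point of the body outside its interior would lie on the Wulff shape, hence on the surface. So
   the part of the ray in the body is both open and closed in the ray. *)
have ray_int : ray `&` wulff_body g `<=` interior (wulff_body g).
  move=> _ [[s /= s0 <-] Ks]; apply: contrapT => nint.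
  have : image_sphere (fun p => l *: dimpled p) (r *: (w + s *: e0) + c).
    rewrite E; exists (w + s *: e0) => //; split=> //.
    exact: subset_closure.
  have -> : r *: (w + s *: e0) + c = l *: ((3 / 5 + l^-1 * (r * s)) *: e0).
    transitivity ((r *: w + c) + (r * s) *: e0).
      by apply/rowP => j; rewrite !mxE; ring.
    by rewrite wE; apply/rowP => j; rewrite !mxE; field.
  move=> [p sp /(scalerI ln0) pE]; apply: (dimpled_not_outside sp).
  have cE a : (a *: e0) 0 0 = a by rewrite mxE ebasis00 mulr1.
  rewrite pE; right; rewrite !dotvE dotv_e0l ebasis00 !cE.
  have : 0 <= l^-1 * (r * s) by rewrite !mulr_ge0 ?invr_ge0// ltW.
  lra.
have : ray `&` wulff_body g = ray.
  apply: cray.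
  - by exists w; split=> //; exists 0; rewrite /= ?lexx// scale0r addr0.
  - exists (interior (wulff_body g)); first exact: open_interior.
    apply/seteqP; split=> y [ry Ky]; split=> //; first exact: ray_int.
    exact: interior_subset.
  - by exists (wulff_body g); first exact: wulff_body_closed.
move=> rayK; have se0 : sphere e0 by apply/sphereP; rewrite dotv_e0l ebasis00.
(* Far enough up the ray, the height exceeds [g e0], against the constraint in direction [e0]. *)
have T0 : 0 <= `|g e0| + `|w 0 0| + 1 by rewrite !addr_ge0.
have : ray (w + (`|g e0| + `|w 0 0| + 1) *: e0) by exists (`|g e0| + `|w 0 0| + 1).
rewrite -rayK => -[_ /(_ _ se0)]; rewrite dotv_e0r coord_axial eqxx mulr1.
have := ler_norm (g e0); have := ler_norm (- w 0 0); rewrite normrN.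
lra.
Qed.

End Conclusion.

Theorem theorem1p4 (R : realType) (n : nat) : (1 <= n)%N ->
  exists g : 'rV[R]_n.+1 -> R,
    [/\ smooth_on_sphere g,
        forall nu, sphere nu -> 0 < g nu,
        ~ convex_integrand g &
        exists (a b : R) (X : R -> 'rV[R]_n.+1 -> 'rV[R]_n.+1),
          [/\ a < b, aniso_mcf g a b X, self_similar_shrinking a b X &
              forall t, a < t < b ->
                ~ exists (r : R) (c : 'rV[R]_n.+1), 0 < r /\
                    image_sphere (X t) = [set r *: w + c | w in wulff_shape g]]].
Proof.
move=> n0; exists (@gam R n); split.
- exact: smooth_on_sphere_gam.
- by move=> nu _; exact: support_gt0.
- exact: gam_not_convex.
- exists (- 1), 0, (fun t p => scale_at t *: dimpled p); split.
  + by rewrite ltrN10.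
  + exact: aniso_mcf_dimpled.
  + exact: self_similar_shrinking_dimpled.
  + by move=> t /andP[_ t0]; apply: dimpled_not_wulff => //; exact: scale_at_gt0.
Qed.
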